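(* Consider the Gaussian state-dependent multiple-access channel with cooperating encoders described in the context in which the only state is a common one, $Y=X_1+X_2+S_0+Z$, with $S_0\sim\mathcal N(0,Q_0)$ known non-causally to both encoders, noise $Z\sim\mathcal N(0,N)$ independent of $S_0$, and power constraints $P_1,P_2$, where $P_1,P_2,Q_0,N>0$. Then its capacity region is the triangle $$\left\{(R_1,R_2):\ R_1\ge0,\ R_2\ge0,\ R_1+R_2\le\frac12\log_2\left(1+\frac{(\sqrt{P_1}+\sqrt{P_2})^2}{N}\right)\right\}.$$
   Context: Channel model. At each time $t=1,\dots,n$ the output is $Y_t=X_{1,t}+X_{2,t}+S_{0,t}+Z_t$, where all $S_{0,t}\sim\mathcal N(0,Q_0)$ and $Z_t\sim\mathcal N(0,N)$ are mutually independent over $t$. Both encoders know $S_0^n$ non-causally. Codes. Encoder $i\in\{1,2\}$ has a message $W_i$ uniform on $\mathcal W_i=\{1,\dots,2^{nR_i}\}$ (rounded down to an integer if necessary); $W_1,W_2$, state and noise are independent. A length-$n$ code consists of (measurable) encoding functions giving $X_{1,j}=f_{1,j}(W_1,S_0^n,X_2^{j-1})$ and $X_{2,j}=f_{2,j}(W_2,S_0^n,X_1^{j-1})$ in $\mathbb R$ for $j=1,\dots,n$ (each encoder observes the other's past real-valued transmitted symbols noiselessly and strictly causally: ''cooperating encoders''), satisfying the average power constraints $\frac1n\sum_{j=1}^n\mathbb E[X_{i,j}^2]\le P_i$, $i=1,2$, together with a (measurable) decoding function $g:\mathbb R^n\to\mathcal W_1\times\mathcal W_2$, $(\hat W_1,\hat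 W_2)=g(Y^n)$. A pair $(R_1,R_2)$ is achievable if there is a sequence of such codes with average error probability $\Pr\{(\hat W_1,\hat W_2)\neq(W_1,W_2)\}\to0$ as $n\to\infty$; the capacity region is the closure of the set of achievable pairs. *)

(* Defs.v *)
From HB Require Import structures.
From mathcomp Require Import all_boot all_order all_algebra.
From mathcomp Require Import all_classical all_reals all_analysis.

Set Implicit Arguments.
Unset Strict Implicit.
Unset Printing Implicit Defensive.

Import Order.TTheory GRing.Theory Num.Theory.
Import numFieldNormedType.Exports.

Local Open Scope classical_set_scope.
Local Open Scope ring_scope.

Section iid.
Context d (T : measurableType d) (R : realType).

Definition cons_tuple n (p : T * n.-tuple T) : n.+1.-tuple T :=
  [the n.+1.-tuple T of p.1 :: p.2].

Lemma measurable_cons_tuple n :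
  measurable_fun [set: T * n.-tuple T] (@cons_tuple n).
Proof. exact: measurable_cons measurable_fst measurable_snd. Qed.

HB.instance Definition _ n :=
  @isMeasurableFun.Build _ _ (T * n.-tuple T)%type (n.+1.-tuple T)
    (@cons_tuple n) (@measurable_cons_tuple n).

(* The law of n independent variables of law P: the n-fold product measure,
   built as the image of P \x P^n by cons. *)
Fixpoint iid (P : probability T R) n : probability (n.-tuple T) R :=
  if n is m.+1 then distribution (P \x iid P m)%E (@cons_tuple m)
  else \d_([tuple]).

End iid.

Section gauss.
Context (R : realType) (v : R).

(* The law N(0, v); normal_prob takes a standard deviation, and lives on
   measurableTypeR R, the copy of R whose Borel sets have another display. *)
Definition gauss (A : set R) : \bar R := normal_prob 0 (Num.sqrt v) A.

Let gauss0 : gauss set0 = 0%E.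
Proof. exact: measure0. Qed.

Let gauss_ge0 A : (0 <= gauss A)%E.
Proof. exact: measure_ge0. Qed.

Let gauss_sigma_additive : semi_sigma_additive gauss.
Proof. exact: (@measure_semi_sigma_additive _ _ _ (normal_prob 0 (Num.sqrt v))). Qed.

HB.instance Definition _ := isMeasure.Build _ _ _
  gauss gauss0 gauss_ge0 gauss_sigma_additive.

Let gauss_setT : gauss setT = 1%E.
Proof. exact: probability_setT. Qed.

HB.instance Definition _ := @Measure_isProbability.Build _ _ R gauss gauss_setT.

End gauss.

Section cooperating_mac.
Context (R : realType).

(* Times are numbered from 0, so at time j an encoder has seen the tuple of the
   j symbols sent so far by the other one. Only enc1 j and enc2 j with j < n
   are ever used. A message set has to be nonempty to carry a uniform message. *)
Record code (n M1 M2 : nat) := Code {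
  enc1 : forall j : nat, 'I_M1 -> n.-tuple R -> j.-tuple R -> R ;
  enc2 : forall j : nat, 'I_M2 -> n.-tuple R -> j.-tuple R -> R ;
  dec : n.-tuple R -> 'I_M1 * 'I_M2 ;
  M1_gt0 : (0 < M1)%N ;
  M2_gt0 : (0 < M2)%N ;
  measurable_enc1 : forall j w, (j < n)%N ->
    measurable_fun [set: n.-tuple R * j.-tuple R] (fun p => @enc1 j w p.1 p.2) ;
  measurable_enc2 : forall j w, (j < n)%N ->
    measurable_fun [set: n.-tuple R * j.-tuple R] (fun p => @enc2 j w p.1 p.2) ;
  measurable_dec : forall w, measurable (dec @^-1` [set w]) }.

Arguments enc1 {n M1 M2} C j w s x : rename.
Arguments enc2 {n M1 M2} C j w s x : rename.

Section code_operation.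
Context (n M1 M2 : nat) (C : code n M1 M2).

Fixpoint inputs (w1 : 'I_M1) (w2 : 'I_M2) (s : n.-tuple R) (k : nat) :
    k.-tuple R * k.-tuple R :=
  if k is j.+1 then
    let: (x1, x2) := inputs w1 w2 s j in
    ([tuple of rcons x1 (enc1 C j w1 s x2)],
     [tuple of rcons x2 (enc2 C j w2 s x1)])
  else ([tuple], [tuple]).

Definition input1 w1 w2 s : n.-tuple R := (inputs w1 w2 s n).1.
Definition input2 w1 w2 s : n.-tuple R := (inputs w1 w2 s n).2.

Definition output w1 w2 (s z : n.-tuple R) : n.-tuple R :=
  [tuple tnth (input1 w1 w2 s) t + tnth (input2 w1 w2 s) t + tnth s t + tnth z t
  | t < n].

(* W1 and W2 are independent, uniform, and independent of the state and noise:
   expectations and probabilities are averages over the message pairs. *)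
Definition msg_mean (F : 'I_M1 -> 'I_M2 -> \bar R) : \bar R :=
  ((M1 * M2)%:R^-1%:E * \sum_(w1 < M1) \sum_(w2 < M2) F w1 w2)%E.

Variables Q0 N : R.

Definition state_law : probability (n.-tuple R) R := iid (gauss Q0) n.
Definition noise_law : probability (n.-tuple R) R := iid (gauss N) n.

(* The inputs do not depend on the noise, so the expectation is over the
   messages and the state. *)
Definition mean_power (X : 'I_M1 -> 'I_M2 -> n.-tuple R -> n.-tuple R) : \bar R :=
  (n%:R^-1%:E * \sum_(j < n)
     msg_mean (fun w1 w2 => 'E_state_law[fun s => (tnth (X w1 w2 s) j ^+ 2)%R]))%E.

Definition power_constraint (P1 P2 : R) :=
  (mean_power input1 <= P1%:E)%E /\ (mean_power input2 <= P2%:E)%E.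

Definition error_prob : \bar R :=
  msg_mean (fun w1 w2 => (state_law \x noise_law)%E
    [set sz | dec C (output w1 w2 sz.1 sz.2) <> (w1, w2)]).

End code_operation.

Definition num_msg (r : R) (n : nat) : nat := Num.truncn (2 `^ (n%:R * r)).

(* The k-th code of a sequence has length k + 1. *)
Definition achievable (P1 P2 Q0 N : R) (r : R * R) : Prop :=
  exists C : forall k, code k.+1 (num_msg r.1 k.+1) (num_msg r.2 k.+1),
    (forall k, power_constraint (C k) Q0 P1 P2) /\
    error_prob (C k) Q0 N @[k --> \oo] --> 0%E.

Definition capacity_region (P1 P2 Q0 N : R) : set (R * R) :=
  closure [set r | achievable P1 P2 Q0 N r].

Definition log2 (x : R) : R := ln x / ln 2.

End cooperating_mac.

(* Main.v *)
Require Import Defs.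
From mathcomp Require Import all_boot all_order all_algebra.
From mathcomp Require Import all_classical all_reals all_analysis measurable_realfun.
From mathcomp Require Import zify ring lra.
Import Order.TTheory GRing.Theory Num.Theory.
Import numFieldNormedType.Exports.
Set Implicit Arguments.
Unset Strict Implicit.
Unset Printing Implicit Defensive.
Local Open Scope classical_set_scope.
Local Open Scope ring_scope.

(** Both encoders can write their whole message into one noiseless real symbol,
    so they act as a single transmitter of power P = (sqrt P1 + sqrt P2)^2.

    Converse: reveal the state to the decoder.  Given the state, the inputs are a
    function of the messages, and the probability of correct decoding is
    compared with that of the same decision region under N(0, P + N)^n; the
    average power enters through Markov's inequality only, which is enough
    because the error probability tends to 0.

    Achievability: Costa's dirty paper code with random codewords from a finite
    grid.  Bin w sends X = U - a S for a codeword U of the bin with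
    |U - a S|^2 <= m P, and the decoder looks for U at distance at most
    sqrt (m D) from a Y, where a = P / (P + N) makes the effective noise
    (1 - a) X - a Z have variance P N / (P + N) per symbol and D is slightly
    larger than that.  A rate is achieved
    when bins are dense enough to cover and the whole codebook is sparse enough
    to pack, which only depends on the ratio of the numbers of grid points in
    balls of radii sqrt (m P) and sqrt (m D). *)

(** * Grid points in balls *)

(** Write [D = rho^2 * P] and let T be the sum rate in nats. Covering needs about |G| / |ball of
    radius sqrt (m P)| codewords per bin; some wrong codeword then passes the decoder's test with
    probability about e^(m T) rho^m, up to a factor linear in m. Acceptance of the true codeword
    asks for rho^2 > N / (P + N), packing asks for rho < e^(-T), and both can be met exactly when T
    < 1/2 ln (1 + P / N). Ball volumes never appear: both ball counts are compared with one
    reference count, up to a factor 2 that does not change the exponent.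

    A finite grid turns averaging over codebooks into counting, so that only state and noise are
    integrated. Its price is that states of large energy must be set aside as a rare event, since
    the balls to be covered around them may leave the grid.

    In the converse, the Markov term P / (P + d) does not vanish, but it is below 1. Above capacity
    the error probability therefore stays away from 0, which contradicts achievability although it
    is not a strong converse. *)

Section grid_counting.
Context (R : realType).
Implicit Types n a b k K : nat.

Lemma sumsq_coord_le n (x : 'I_n -> R) (r : R) i :
  0 <= r -> \sum_i x i ^+ 2 <= r ^+ 2 -> `|x i| <= r.
Proof.
move=> r0 xr; rewrite -(ler_pXn2r (ltn0Sn 1)) ?nnegrE// real_normK ?num_real//.
apply: le_trans xr; rewrite (bigD1 i)//= lerDl.
by apply: sumr_ge0 => j _; exact: sqr_ge0.
Qed.

(** Each cross term is at most [2 * r], so the square grows by at most [n * (2 * r + 1)]. The excess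
    [n.+1] in the radius is cruder than sqrt n, but [central_ball_pigeonhole] absorbs it. *)
Lemma sumsq_perturb n (x e : 'I_n -> R) (r : R) :
  0 <= r -> \sum_i x i ^+ 2 <= r ^+ 2 -> (forall i, `|e i| <= 1) ->
  \sum_i (x i + e i) ^+ 2 <= (r + n.+1%:R) ^+ 2.
Proof.
move=> r0 xr e1.
apply: (@le_trans _ _ (\sum_i x i ^+ 2 + \sum_(i < n) (r *+ 2 + 1))).
  rewrite -big_split/=; apply: ler_sum => i _.
  have := sumsq_coord_le i r0 xr; have := e1 i; rewrite !ler_norml.
  move=> /andP[? ?] /andP[? ?]; nra.
rewrite sumr_const card_ord -mulr_natl -(natr1 n).
have := ler0n R n; nra.
Qed.

Lemma euclid_uniq (x y : int) (b e e' : nat) : (e < b)%N -> (e' < b)%N ->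
  b%:Z * x + e%:Z = b%:Z * y + e'%:Z -> x = y /\ e = e'.
Proof.
move=> eb e'b E; have [xy|xy|xy] := ltgtP x y; last first.
  by split=> //; move: E; rewrite xy => /addrI[].
  have : b%:Z * 1 <= b%:Z * (x - y) by apply: ler_wpM2l => //; lia.
  by rewrite mulrBr; lia.
have : b%:Z * 1 <= b%:Z * (y - x) by apply: ler_wpM2l => //; lia.
by rewrite mulrBr; lia.
Qed.

(** The box is finite with natural coordinates so that codebooks form a [finType]. Upper bounds on
    the count hold for every box; lower bounds need the ball to lie inside it. *)
Definition ball_grid n (c : 'I_n -> R) (r : R) K : {set {ffun 'I_n -> 'I_K}} :=
  [set g : {ffun 'I_n -> 'I_K} | \sum_i ((g i)%:R - c i) ^+ 2 <= r ^+ 2].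

(** These are all integer points of the ball of radius k around 0, shifted by k to become natural
    numbers. *)
Definition central_ball n k := ball_grid (fun _ : 'I_n => k%:R) k%:R k.*2.+1.

Lemma card_central_ball_gt0 n k : (0 < #|central_ball n k|)%N.
Proof.
apply/card_gt0P; exists [ffun=> inord k]; rewrite inE big1 ?sqr_ge0// => i _.
by rewrite ffunE inordK ?subrr ?expr0n// -addnn ltnS leq_addr.
Qed.

Lemma card_central_ball_le n k : (#|central_ball n k| <= k.*2.+1 ^ n)%N.
Proof. by apply: leq_trans (max_card _) _; rewrite card_ffun !card_ord. Qed.

(* Reduction modulo a.+1: g is determined by its coordinatewise remainder and by
   its quotient, which lies in a ball smaller by the factor a.+1. *)
Lemma card_ball_grid_le n (c : 'I_n -> R) a k K :
  (#|ball_grid c (a.+1%:R * k%:R) K| <=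
   a.+1 ^ n * #|central_ball n (k + n.+1)|)%N.
Proof.
pose k' := (k + n.+1)%N.
(* Both [g i] and the centre are rounded down, with errors in [0, 1); the difference of the two
   errors stays within 1, as [sumsq_perturb] requires. *)
pose t (g : {ffun 'I_n -> 'I_K}) i : int :=
  (g i %/ a.+1)%:Z - Num.floor (c i / a.+1%:R).
pose f (g : {ffun 'I_n -> 'I_K}) :
    {ffun 'I_n -> 'I_a.+1} * {ffun 'I_n -> 'I_(k'.*2.+1)} :=
  ([ffun i => inord (g i %% a.+1)], [ffun i => inord (absz (t g i + k'%:Z))]).
have a0 : (0 : R) < a.+1%:R by rewrite ltr0n.
have tE g : g \in ball_grid c (a.+1%:R * k%:R) K ->
    \sum_i ((t g i)%:~R : R) ^+ 2 <= k'%:R ^+ 2.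
  rewrite inE => gB.
  have xB : \sum_i (((g i)%:R - c i) / a.+1%:R) ^+ 2 <= (k%:R : R) ^+ 2.
    under eq_bigr do rewrite exprMn.
    rewrite -mulr_suml exprVn ler_pdivrMr ?exprn_gt0//.
    by rewrite -exprMn mulrC.
  have := @sumsq_perturb n _
    (fun i => (t g i)%:~R - ((g i)%:R - c i) / a.+1%:R) _ (ler0n _ k) xB.
  rewrite /k' natrD => H; under eq_bigr => i _ do
    rewrite -(subrKC (((g i)%:R - c i) / a.+1%:R) (t g i)%:~R).
  apply: H => i; rewrite /t intrB.
  have /andP[f1 f2] := floor_itv (c i / a.+1%:R).
  set fl := Num.floor _ in f1 f2 *.
  have gE : ((g i)%:R : R) = (g i %/ a.+1)%:R * a.+1%:R + (g i %% a.+1)%:R.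
    by rewrite -natrM -natrD -divn_eq.
  have r1 : ((g i %% a.+1)%:R : R) < a.+1%:R by rewrite ltr_nat ltn_mod.
  have r0 := ler0n R (g i %% a.+1).
  have -> : ((g i)%:R - c i) / a.+1%:R =
      (g i %/ a.+1)%:R + (g i %% a.+1)%:R / a.+1%:R - c i / a.+1%:R :> R.
    by rewrite gE; field; rewrite gt_eqF.
  have q0 : 0 <= (g i %% a.+1)%:R / a.+1%:R :> R by rewrite divr_ge0// ltW.
  have q1 : (g i %% a.+1)%:R / a.+1%:R < 1 :> R by rewrite ltr_pdivrMr// mul1r.
  rewrite intrD mulr1z in f2.
  move: (c i / _) (_ / a.+1%:R) f1 f2 q0 q1 => x y *.
  by rewrite ler_norml -pmulrn; apply/andP; split; lra.
have tk g : g \in ball_grid c (a.+1%:R * k%:R) K -> forall i,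
    (absz (t g i + k'%:Z)%R < k'.*2.+1)%N /\ (absz (t g i + k'%:Z))%:Z = t g i + k'%:Z.
  move=> gB i.
  have := sumsq_coord_le i (ler0n _ k') (tE _ gB).
  by rewrite -intr_norm pmulrn ler_int; lia.
have injf : {in ball_grid c (a.+1%:R * k%:R) K &, injective f}.
  move=> g g' gB g'B [/ffunP e1 /ffunP e2]; apply/ffunP => i; apply/val_inj => /=.
  have := e1 i; rewrite !ffunE => /(congr1 val)/=.
  rewrite !inordK ?ltn_mod// => m1.
  have := e2 i; rewrite !ffunE => /(congr1 val)/=.
  have [? ?] := tk _ gB i; have [? ?] := tk _ g'B i.
  rewrite !inordK// => m2.
  rewrite (divn_eq (g i) a.+1) (divn_eq (g' i) a.+1) m1; congr (_ * _ + _)%N.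
  have : t g i + k'%:Z = t g' i + k'%:Z by congruence.
  by move=> /addIr/addIr[].
rewrite -(card_in_imset injf).
have -> : (a.+1 ^ n * #|central_ball n k'|)%N =
    #|finset.setX [set: {ffun 'I_n -> 'I_a.+1}]%SET (central_ball n k')|.
  by rewrite cardsX cardsT card_ffun !card_ord.
apply/subset_leq_card/fintype.subsetP => _ /imsetP[g gB ->].
rewrite finset.in_setX finset.in_setT /= inE; apply: le_trans (tE _ gB).
rewrite le_eqVlt; apply/orP; left; apply/eqP; apply: eq_bigr => i _.
have [? E] := tk _ gB i.
by rewrite ffunE inordK// (pmulrn _ (absz _)) E intrD addrK.
Qed.

(** The reduction modulo [b.+1] is run backwards: a quotient in the ball of radius k and an
    arbitrary remainder determine a point, and rounding the centre enlarges the radius by [n.+1]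
    units of [b.+1]. The hypothesis keeps the ball inside the box, so [inord] truncates nothing. *)
Lemma card_ball_grid_ge n (c : 'I_n -> R) b k K :
  (forall i, b.+1%:R * (k + n.+1)%:R <= c i /\
     c i + b.+1%:R * (k + n.+1)%:R <= K%:R) ->
  (b.+1 ^ n * #|central_ball n k| <=
   #|ball_grid c (b.+1%:R * (k + n.+1)%:R) K.+1|)%N.
Proof.
move=> cK.
pose t (p : {ffun 'I_n -> 'I_b.+1} * {ffun 'I_n -> 'I_(k.*2.+1)}) i : int :=
  b.+1%:Z * ((p.2 i)%:Z - k%:Z + Num.floor (c i / b.+1%:R)) + (p.1 i)%:Z.
pose f p : {ffun 'I_n -> 'I_K.+1} := [ffun i => inord (absz (t p i))].
set A := finset.setX [set: {ffun 'I_n -> 'I_b.+1}]%SET (central_ball n k).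
have b0 : (0 : R) < b.+1%:R by rewrite ltr0n.
have tE p : p \in A ->
    \sum_i ((t p i)%:~R - c i : R) ^+ 2 <= (b.+1%:R * (k + n.+1)%:R) ^+ 2.
  rewrite finset.inE => /andP[_]; rewrite inE => pB.
  have := @sumsq_perturb n _
    (fun i => ((t p i)%:~R - c i) / b.+1%:R - ((p.2 i)%:R - k%:R)) _ (ler0n _ k) pB.
  under eq_bigr do rewrite subrKC exprMn.
  rewrite -mulr_suml exprVn ler_pdivrMr ?exprn_gt0// -natrD -exprMn mulrC; apply => i.
  have /andP[f1 f2] := floor_itv (c i / b.+1%:R).
  rewrite /t; set fl := Num.floor _ in f1 f2 *.
  have r1 : ((p.1 i)%:R : R) < b.+1%:R by rewrite ltr_nat.
  have r0 := ler0n R (p.1 i).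
  rewrite intrD mulr1z in f2; rewrite intrD intrM intrD intrB -!pmulrn.
  have -> : (b.+1%:R * ((p.2 i)%:R - k%:R + fl%:~R) + (p.1 i)%:R - c i) / b.+1%:R -
      ((p.2 i)%:R - k%:R) = fl%:~R + (p.1 i)%:R / b.+1%:R - c i / b.+1%:R :> R.
    by field; rewrite gt_eqF.
  have q0 : 0 <= (p.1 i)%:R / b.+1%:R :> R by rewrite divr_ge0// ltW.
  have q1 : (p.1 i)%:R / b.+1%:R < 1 :> R by rewrite ltr_pdivrMr// mul1r.
  move: (c i / _) (_ / b.+1%:R) f1 f2 q0 q1 => x y *.
  by rewrite ler_norml; apply/andP; split; lra.
have tk p : p \in A -> forall i,
    (absz (t p i) < K.+1)%N /\ (absz (t p i))%:Z = t p i.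
  move=> pA i.
  have r0 : 0 <= b.+1%:R * (k + n.+1)%:R :> R by rewrite mulr_ge0.
  have := sumsq_coord_le i r0 (tE _ pA).
  have [c1 c2] := cK i; rewrite ler_norml => /andP[t1 t2].
  have : (0 : R) <= (t p i)%:~R by lra.
  have : ((t p i)%:~R : R) <= K%:~R by rewrite -pmulrn; lra.
  by rewrite ler_int ler0z; lia.
have injf : {in A &, injective f}.
  move=> p p' pA p'A /ffunP e.
  have H i : p.1 i = p'.1 i /\ p.2 i = p'.2 i.
    have := e i; rewrite !ffunE => /(congr1 val)/=.
    have [? ?] := tk _ pA i; have [? ?] := tk _ p'A i.
    rewrite !inordK// => m2.
    have l1 := ltn_ord (p.1 i); have l2 := ltn_ord (p'.1 i).
    have : t p i = t p' i by congruence.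
    rewrite /t => {}m2.
    have [E1 E2] := euclid_uniq l1 l2 m2.
    have {}E1 : (p.2 i : nat) = p'.2 i by move: E1 => /addIr/addIr[].
    by split; apply/val_inj.
  case: p p' H {e pA p'A} => p1 p2 [p1' p2']/= H.
  by congr pair; apply/ffunP => i; have [] := H i.
have -> : (b.+1 ^ n * #|central_ball n k|)%N = #|A|.
  by rewrite cardsX cardsT card_ffun !card_ord.
rewrite -(card_in_imset injf).
apply/subset_leq_card/fintype.subsetP => _ /imsetP[p pA ->].
rewrite inE; apply: le_trans (tE _ pA).
rewrite le_eqVlt; apply/orP; left; apply/eqP; apply: eq_bigr => i _.
have [? E] := tk _ pA i.
by rewrite ffunE inordK// (pmulrn _ (absz _)) E.
Qed.

Lemma polynomial_lt_exp2 n : exists j, ((4 * (j * n.+1)).+1 ^ n < 2 ^ j)%N.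
Proof.
(* With j = 2^(2u) the base is at most 2^(2u + n + 3), and (2u + n + 3) n < (u + 1)^2 <= 2^(2u) =
   j. *)
pose u := (3 * n + 3)%N; exists (2 ^ u.*2)%N.
have n1 : (n.+1 <= 2 ^ n)%N by exact: ltn_expl.
apply: (@leq_ltn_trans ((2 ^ (u.*2 + n + 3)) ^ n)%N).
  have mono x y m : (x <= y -> x ^ m <= y ^ m)%N.
    by move=> xy; elim: m => // m IH; rewrite !expnS leq_mul.
  apply: mono.
  have -> : (2 ^ (u.*2 + n + 3) = 4 * (2 ^ u.*2 * 2 ^ n) * 2)%N.
    by rewrite !expnD; lia.
  have : (0 < 2 ^ u.*2)%N by rewrite expn_gt0.
  by move: (2 ^ u.*2)%N (2 ^ n)%N n1 => x y; nia.
rewrite -expnM ltn_exp2l//.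
have u1 : (u.+1 <= 2 ^ u)%N by exact: ltn_expl.
rewrite -addnn expnD; nia.
Qed.

(* Otherwise the count would grow exponentially in the radius, whereas it is
   polynomial. This replaces any knowledge of the volume of balls. *)
Lemma central_ball_pigeonhole n :
  exists k, (#|central_ball n (k + (n.+1).*2)| <= 2 * #|central_ball n k|)%N.
Proof.
apply: contrapT => H.
have {}H k : (2 * #|central_ball n k| < #|central_ball n (k + n.+1.*2)|)%N.
  by rewrite ltnNge; apply/negP => ?; apply: H; exists k.
have lb j : (2 ^ j <= #|central_ball n (j * n.+1.*2)|)%N.
  elim: j => [|j IH]; first by rewrite card_central_ball_gt0.
  rewrite expnS (mulSn j) addnC.
  by apply: leq_trans (ltnW (H _)); rewrite leq_mul2l IH orbT.
have [j] := polynomial_lt_exp2 n; rewrite ltnNge => /negP; apply.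
apply: (leq_trans (lb j)).
have := card_central_ball_le n (j * n.+1.*2).
by have -> : (4 * (j * n.+1) = (j * n.+1.*2).*2)%N by lia.
Qed.

End grid_counting.

(** Both radii are integer multiples, by [b.+1] and [a.+1], of [r = k + m.+1] mesh steps. The lower
    count refers to the central ball of radius k and the upper one to radius [k + (m.+1).*2], one
    rounding on each side; the pigeonhole makes the two references agree up to the factor 2. *)
Lemma grid_counting (R : realType) m (a b : nat) (P A : R) :
  (0 < m)%N -> 0 < P -> 0 <= A ->
  exists (G : finType) (pos : G -> 'I_m -> R) (B : nat),
  [/\ (0 < B)%N,
   forall x : 'I_m -> R, \sum_i x i ^+ 2 <= A ^+ 2 ->
     (b.+1 ^ m * B <=
      #|[set g : G | (\sum_i (pos g i - x i) ^+ 2 <= m%:R * P)%R]%SET|)%N &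
   forall x : 'I_m -> R,
     (#|[set g : G | (\sum_i (pos g i - x i) ^+ 2 <=
            m%:R * ((a.+1%:R / b.+1%:R) ^+ 2 * P))%R]%SET| <=
      2 * a.+1 ^ m * B)%N ].
Proof.
move=> m0 P0 A0.
have [k kB] := central_ball_pigeonhole R m.
pose r := (k + m.+1)%N.
have r0 : (0 : R) < r%:R by rewrite ltr0n /r; lia.
have b0 : (0 : R) < b.+1%:R by rewrite ltr0n.
have mP : 0 < m%:R * P by rewrite mulr_gt0// ltr0n.
(* The mesh is chosen so that radius sqrt (m P) is exactly [b.+1 * r] steps. *)
pose h := Num.sqrt (m%:R * P) / (b.+1%:R * r%:R).
have h0 : 0 < h by rewrite divr_gt0 ?mulr_gt0// sqrtr_gt0.
(* Half-width of the box in steps: a ball of radius sqrt (m P) around any point of norm at most [A]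
   fits. *)
pose K0 := (Num.truncn (A / h + b.+1%:R * r%:R)).+1.
have K0E : A / h + b.+1%:R * r%:R <= K0%:R by exact/ltW/truncnS_gt.
pose pos (g : {ffun 'I_m -> 'I_(K0 + K0).+1}) (i : 'I_m) : R :=
  h * ((g i)%:R - K0%:R).
have hE : h ^+ 2 * (b.+1%:R * r%:R) ^+ 2 = m%:R * P.
  by rewrite -exprMn /h divfK ?sqr_sqrtr ?(ltW mP)// gt_eqF ?mulr_gt0.
have posE g x : \sum_i (pos g i - x i) ^+ 2 =
    h ^+ 2 * \sum_i ((g i)%:R - (K0%:R + x i / h)) ^+ 2.
  rewrite mulr_sumr; apply: eq_bigr => i _; rewrite -exprMn /pos.
  by congr (_ ^+ 2); field; rewrite gt_eqF.
have ballE x (c : R) :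
    #|[set g | (\sum_i (pos g i - x i) ^+ 2 <= h ^+ 2 * c ^+ 2)%R]%SET| =
    #|ball_grid (fun i => K0%:R + x i / h) c (K0 + K0).+1|.
  apply: eq_card => g; rewrite !inE posE ler_pM2l// exprn_gt0//.
exists {ffun 'I_m -> 'I_(K0 + K0).+1}, pos, #|central_ball R m k|; split.
- exact: card_central_ball_gt0.
- move=> x xA; rewrite -hE ballE; apply: card_ball_grid_ge => i.
  have := sumsq_coord_le i A0 xA; rewrite ler_norml => /andP[x1 x2].
  have {}x1 : - (A / h) <= x i / h by rewrite -mulNr ler_pM2r ?invr_gt0.
  have {}x2 : x i / h <= A / h by rewrite ler_pM2r ?invr_gt0.
  rewrite -/r natrD; move: (x i / h) (A / h) x1 x2 K0E => x' A' *; split; lra.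
- move=> x.
  have -> : m%:R * ((a.+1%:R / b.+1%:R) ^+ 2 * P) = h ^+ 2 * (a.+1%:R * r%:R) ^+ 2.
    by rewrite mulrCA -hE; field; rewrite gt_eqF.
  rewrite ballE; apply: leq_trans (card_ball_grid_le _ _ _ _) _.
  rewrite -mulnA mulnCA leq_mul2l; apply/orP; right; apply: leq_trans kB.
  by rewrite /r -addnA addnn.
Qed.

(** * Random codebooks *)

Section random_codebook.
Variables (W G : finType) (L : nat).
Local Notation codebook := {ffun W * 'I_L -> G}.

(** Entries of other bins are free, and each of the L entries of bin w avoids [S] with frequency at
    most [1 - q <= expR (- q)]. The count is a product over entries. *)
Lemma card_codebook_miss (R : realType) (w : W) (S : {set G}) (q : R) :
  q * #|G|%:R <= #|S|%:R ->
  #|[set u : codebook | [forall l, u (w, l) \notin S]]%SET|%:R <=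
    expR (- (q * L%:R)) * #|codebook|%:R :> R.
Proof.
move=> qS.
have -> : [set u : codebook | [forall l, u (w, l) \notin S]]%SET =
   [set u : codebook in family (fun p => if p.1 == w then mem (~: S) else mem G)]%SET.
  apply/setP => u; rewrite !inE; apply/forallP/familyP => /= H.
    move=> [w' l]/=; case: eqP => [->|]; last by rewrite inE.
    by rewrite finset.inE; exact: H.
  by move=> l; have := H (w, l); rewrite /= eqxx finset.inE.
rewrite cardsE card_family card_ffun foldrE big_map big_enum/=.
rewrite natr_prod natrX -prodr_const.
rewrite -(pair_bigA _ (fun p l => #|if p == w then mem (~: S) else mem G|%:R))/=.
rewrite -(pair_bigA _ (fun (_ : W) (_ : 'I_L) => #|G|%:R))/=.
rewrite (bigD1 w)//= [X in _ <= _ * X](bigD1 w)//= eqxx mulrA.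
have -> : \prod_(i | i != w) \prod_(j < L) #|if i == w then mem (~: S) else mem G|%:R
   = \prod_(i | i != w) \prod_(j < L) #|G|%:R :> R.
  by apply: eq_bigr => i /negPf ->.
apply: ler_wpM2r; first by apply: prodr_ge0 => i _; apply: prodr_ge0.
rewrite !prodr_const card_ord -mulNr expRM_natr -exprMn.
rewrite lerXn2r ?nnegrE ?mulr_ge0 ?expR_ge0//.
rewrite cardsCs finset.setCK natrB ?max_card//.
apply: (@le_trans _ _ ((1 - q) * #|G|%:R)); first by rewrite mulrBl mul1r; lra.
by rewrite ler_wpM2r// expR_ge1Dx.
Qed.

(* Exchange the codeword at i with an independent one. *)
Lemma card_codebook_hit (i : W * 'I_L) (T : codebook -> {set G}) t :
  (forall u u' : codebook, (forall j, j != i -> u j = u' j) -> T u = T u') ->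
  (forall u : codebook, (#|T u| <= t)%N) ->
  (#|G| * #|[set u : codebook | u i \in T u]%SET| <= t * #|codebook|)%N.
Proof.
move=> Tdep Tle.
pose upd u g : codebook := [ffun j => if j == i then g else u j].
(* [phi] swaps the entry at i with the spare codeword. By [Tdep] the set [T] does not notice, so
   after reindexing it is the free codeword that must fall in a set of size at most t. *)
pose phi (p : codebook * G) := (upd p.1 p.2, p.1 i).
have phiK : involutive phi.
  move=> [u g]; rewrite /phi/=; congr pair; last by rewrite ffunE eqxx.
  by apply/ffunP => j; rewrite !ffunE; case: eqP => [->|].
have -> : (#|G| * #|[set u : codebook | u i \in T u]%SET| =
    \sum_(p : codebook * G) (p.1 i \in T p.1))%N.
  rewrite -(pair_bigA _ (fun (u : codebook) (_ : G) => (u i \in T u) : nat))/=.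
  rewrite -sum1dep_card big_mkcond/= big_distrr/=; apply: eq_bigr => u _.
  by rewrite sum_nat_const; case: (u i \in T u).
rewrite (reindex_inj (inv_inj phiK))/=.
rewrite -(pair_bigA _ (fun (u : codebook) (g : G) => (upd u g i \in T (upd u g)) : nat))/=.
rewrite mulnC -sum_nat_const; apply: leq_sum => u _.
apply: leq_trans (Tle u); rewrite -sum1_card [leqRHS]big_mkcond/=.
apply: leq_sum => g _; rewrite ffunE eqxx.
rewrite (Tdep (upd u g) u); first by case: ifP.
by move=> j /negPf ji; rewrite ffunE ji.
Qed.

End random_codebook.

(** * Integration against densities, Gaussian laws and product laws *)

Lemma measurable_superlevel d (T : measurableType d) (R : realType) (f : T -> R) t :
  measurable_fun [set: T] f -> measurable [set x | t <= f x].
Proof.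
move=> mf; have -> : [set x | t <= f x] = f @^-1` `[t, +oo[.
  by apply/seteqP; split=> x /=; rewrite in_itv/= andbT.
by rewrite -[X in measurable X]setTI; exact: mf.
Qed.

Lemma measurable_strict_superlevel d (T : measurableType d) (R : realType) (f : T -> R) t :
  measurable_fun [set: T] f -> measurable [set x | t < f x].
Proof.
move=> mf; have -> : [set x | t < f x] = f @^-1` `]t, +oo[.
  by apply/seteqP; split=> x /=; rewrite in_itv/= andbT.
by rewrite -[X in measurable X]setTI; exact: mf.
Qed.

Section density.
Context d (T : measurableType d) (R : realType).
Variables (mu nu : {measure set T -> \bar R}) (w : T -> R).
Hypotheses (mw : measurable_fun [set: T] w) (w0 : forall x, 0 <= w x).
Hypothesis nuE : forall A, measurable A -> nu A = (\int[mu]_(x in A) (w x)%:E)%E.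

Import HBNNSimple.

Let integral_density_nnsfun (f : {nnsfun T >-> R}) :
  (\int[nu]_x (f x)%:E = \int[mu]_x ((f x)%:E * (w x)%:E))%E.
Proof.
under [LHS]eq_integral do rewrite fimfunE -fsumEFin//.
rewrite [LHS]ge0_integral_fsum//; last 2 first.
  - by move=> r; exact/measurable_EFinP/measurableT_comp.
  - by move=> n x _; rewrite EFinM nnfun_muleindic_ge0.
under [RHS]eq_integral.
  move=> x xD; rewrite fimfunE -fsumEFin// muleC ge0_mule_fsumr; last first.
    by move=> r; rewrite EFinM nnfun_muleindic_ge0.
  over.
rewrite [RHS]ge0_integral_fsum//; last 2 first.
  - move=> r; apply: emeasurable_funM; first exact/measurable_EFinP.
    by apply/measurable_EFinP; exact/measurableT_comp.
  - move=> n x _; rewrite EFinM mule_ge0//; last by rewrite nnfun_muleindic_ge0.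
    by rewrite lee_fin.
apply: eq_fsbigr => r _.
rewrite integralZl_indic_nnsfun//= integral_indic// setIT nuE//.
have [r0|r0] := ltP r 0%R.
  rewrite preimage_nnfun0// integral_set0 mule0.
  apply/esym/integral0_eq => x _.
  by rewrite indic0 mulr0 mule0.
rewrite [in LHS]integral_mkcond -ge0_integralZl//.
- apply: eq_integral => x _; rewrite patchE indicE.
  by case: ifPn => _; rewrite ?mulr1 ?mulr0 ?mule0 // muleC.
- apply/(measurable_restrictT _ _).1 => //.
  by apply/measurable_funTS/measurable_EFinP.
- by move=> x _; rewrite patchE; case: ifPn; rewrite // lee_fin.
Qed.

Lemma ge0_integral_density (f : T -> \bar R) :
  measurable_fun [set: T] f -> (forall x, 0 <= f x)%E ->
  (\int[nu]_x f x = \int[mu]_x (f x * (w x)%:E))%E.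
Proof.
move=> mf f0.
pose f_ := nnsfun_approx measurableT mf.
transitivity (lim (\int[nu]_x (f_ n x)%:E @[n --> \oo])%E).
  rewrite -monotone_convergence//=.
  - apply: eq_integral => ? /[!inE] xD; apply/esym/cvg_lim => //=.
    exact: cvg_nnsfun_approx.
  - by move=> n; exact/measurable_EFinP/measurable_funTS.
  - by move=> n ? _; rewrite lee_fin.
  - by move=> ? _ ? ? mn; rewrite lee_fin; exact/lefP/nd_nnsfun_approx.
under eq_fun do rewrite integral_density_nnsfun.
rewrite -monotone_convergence//=.
- apply: eq_integral => x _; apply/cvg_lim => //=.
  by apply: cvgeZr => //; exact: cvg_nnsfun_approx.
- by move=> n; apply: emeasurable_funM; apply/measurable_EFinP.
- by move=> n ? _; rewrite mule_ge0// lee_fin.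
- move=> x _ ? ? mn; apply: lee_wpmul2r; first by rewrite lee_fin.
  by rewrite lee_fin; exact/lefP/nd_nnsfun_approx.
Qed.

End density.

Section gauss.
Context (R : realType).
Local Notation mu := (@lebesgue_measure R).

Lemma ge0_integral_gauss (v : R) (f : R -> \bar R) :
  measurable_fun [set: R] f -> (forall x, 0 <= f x)%E ->
  (\int[gauss v]_x f x =
   \int[mu]_x (f x * (normal_pdf 0 (Num.sqrt v) x)%:E))%E.
Proof.
move=> mf f0.
(* The identity, as a measurable map from the copy of R that carries [normal_prob] to R itself. *)
pose I : measurableTypeR R -> R := idfun.
have mI : measurable_fun [set: measurableTypeR R] I by move=> _ A mA; rewrite setTI.
transitivity (\int[pushforward (normal_prob 0 (Num.sqrt v)) I]_x f x)%E.
  by apply: eq_measure_integral => A mA _.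
rewrite ge0_integral_pushforward//.
rewrite (@ge0_integral_density _ _ _ mu _ (normal_pdf 0 (Num.sqrt v)))//.
- exact: measurable_normal_pdf.
- exact: normal_pdf_ge0.
Qed.

(** The image of Lebesgue measure under the shift agrees with it on half-open intervals, hence
    everywhere by uniqueness. *)
Lemma ge0_integral_lebesgue_shift (c : R) (f : R -> \bar R) :
  measurable_fun [set: R] f -> (forall x, 0 <= f x)%E ->
  (\int[mu]_x f (c + x)%R = \int[mu]_x f x)%E.
Proof.
move=> mf f0.
pose S : measurableTypeR R -> measurableTypeR R := fun x => c + x.
have mS : measurable_fun [set: measurableTypeR R] S.
  by apply: measurable_funD => //; exact: measurable_cst.
transitivity (\int[pushforward mu S]_x f x)%E.
  by rewrite ge0_integral_pushforward.
apply: eq_measure_integral => A mA _; apply/esym.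
apply: lebesgue_measure_unique => // _ [[a b]] _ <-.
rewrite /pushforward/=.
rewrite [X in _ = mu X](_ : _ = [set` `]a - c, b - c]]); last first.
  by apply/seteqP; split=> x; rewrite /S/= !in_itv/= ltrBlDl lerBrDl.
rewrite !lebesgue_measure_itv/= !lte_fin ltrD2r -!EFinB.
by case: ifP => // _; congr EFin; ring.
Qed.

End gauss.

Lemma measurable_mktuple d (T : measurableType d) d' (T' : measurableType d') n
    (F : T -> 'I_n -> T') : (forall i, measurable_fun [set: T] (F ^~ i)) ->
  measurable_fun [set: T] (fun t => [tuple F t i | i < n]).
Proof.
move=> mF; apply/measurable_fun_tnthP => i /=.
by apply: (eq_measurable_fun (F ^~ i)) => // t _; rewrite /= tnth_mktuple.
Qed.

Section iid_integral.
Context d (T : measurableType d) (R : realType) (P : probability T R).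

Lemma ge0_integral_iidS n (f : n.+1.-tuple T -> \bar R) :
  measurable_fun [set: n.+1.-tuple T] f -> (forall t, 0 <= f t)%E ->
  (\int[iid P n.+1]_t f t =
   \int[P]_x \int[iid P n]_t f (Defs.cons_tuple (x, t)))%E.
Proof.
move=> mf f0 /=; rewrite ge0_integral_distribution//.
rewrite fubini_tonelli1// => [|p]; last exact: f0.
exact: measurableT_comp mf (@Defs.measurable_cons_tuple _ _ _).
Qed.

Lemma ge0_integral_iid0 (f : 0.-tuple T -> \bar R) :
  measurable_fun [set: 0.-tuple T] f ->
  (\int[iid P 0]_t f t = f [tuple])%E.
Proof. by move=> mf /=; rewrite integral_dirac// diracT mul1e. Qed.

Lemma measurable_iid_inner n (f : n.+1.-tuple T -> \bar R) :
  measurable_fun [set: n.+1.-tuple T] f -> (forall t, 0 <= f t)%E ->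
  measurable_fun [set: T] (fun x => \int[iid P n]_t f (Defs.cons_tuple (x, t)))%E.
Proof.
move=> mf f0.
apply: (measurable_fun_fubini_tonelli_F (m2 := iid P n) (f \o @Defs.cons_tuple _ _ n)).
  exact: measurableT_comp mf (@Defs.measurable_cons_tuple _ _ _).
by move=> p; exact: f0.
Qed.

End iid_integral.

(** * Gaussian tails and change of measure *)

Section gaussian_moments.
Context (R : realType).
Local Notation mu := (@lebesgue_measure R).

(** Here 1 / (1 - x) = 1 + x / (1 - x) <= exp (x / (1 - x)), and x / (1 - x) <= x + 2 x^2 amounts to
    x^2 (1 - 2 x) >= 0. It makes the factor (1 - 2 l v)^(-1/2) of a Gaussian moment exponential of a
    quadratic. *)
Lemma inv_onem_le (x : R) : x <= 2^-1 -> (1 - x)^-1 <= expR (x + 2 * x ^+ 2).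
Proof.
move=> x2; have x1 : 0 < 1 - x by lra.
apply: (@le_trans _ _ (1 + x / (1 - x))).
  rewrite le_eqVlt; apply/orP; left; apply/eqP; field; lra.
apply: le_trans (expR_ge1Dx _) _; rewrite ler_expR ler_pdivrMr//.
rewrite -subr_ge0.
have -> : (x + 2 * x ^+ 2) * (1 - x) - x = x ^+ 2 * (1 - 2 * x) by ring.
by rewrite mulr_ge0 ?sqr_ge0//; lra.
Qed.

(** Completing the square turns the integrand into a constant times the density of N(m v', v') with
    v' = v / (1 - 2 l v). The ratio of the peaks is (1 - 2 l v)^(-1/2), and v' <= 2 v bounds the
    remaining exponent m^2 v' / 2. The parameter [l] may be negative. *)
Lemma gauss_exp_moment (v l m : R) : 0 < v -> 2 * l * v <= 2^-1 ->
  (\int[gauss v]_x (expR (l * x ^+ 2 + m * x))%:E <=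
   (expR (l * v + 4 * l ^+ 2 * v ^+ 2 + m ^+ 2 * v))%:E)%E.
Proof.
move=> v0 lv.
pose x := 2 * l * v; have x1 : 0 < 1 - x by rewrite /x; lra.
pose v' := v / (1 - x); have v'0 : 0 < v' by rewrite divr_gt0.
have sv : Num.sqrt v != 0 by rewrite gt_eqF ?sqrtr_gt0.
have sv' : Num.sqrt v' != 0 by rewrite gt_eqF ?sqrtr_gt0.
have mexp : measurable_fun [set: R] (fun y => (expR (l * y ^+ 2 + m * y))%:E).
  apply/measurable_EFinP/measurableT_comp => //.
  by apply: measurable_funD; apply: measurable_funM => //; exact: measurable_funX.
rewrite ge0_integral_gauss//.
pose C := normal_peak (Num.sqrt v) / normal_peak (Num.sqrt v') *
  expR (m ^+ 2 * v' / 2).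
have C0 : 0 <= C by rewrite mulr_ge0 ?divr_ge0 ?normal_peak_ge0 ?expR_ge0.
rewrite (eq_integral
    (fun y : measurableTypeR R => (C%:E * (normal_pdf (m * v') (Num.sqrt v') y)%:E)%E)); last first.
  move=> y _; rewrite -!EFinM !normal_pdfE// /C /normal_fun; congr EFin.
  rewrite subr0 !sqr_sqrtr ?ltW//.
  have -> : normal_peak (Num.sqrt v) / normal_peak (Num.sqrt v') *
    expR (m ^+ 2 * v' / 2) * (normal_peak (Num.sqrt v') *
    expR (- (y - m * v') ^+ 2 / (v' *+ 2))) = normal_peak (Num.sqrt v) *
    (expR (m ^+ 2 * v' / 2) * expR (- (y - m * v') ^+ 2 / (v' *+ 2))).
    by field; rewrite gt_eqF ?normal_peak_gt0.
  rewrite mulrCA -!expRD; congr (_ * expR _); rewrite /v' /x; field.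
  by rewrite !gt_eqF// -/x; lra.
rewrite ge0_integralZl//; last 2 first.
- by apply/measurable_EFinP; exact: measurable_normal_pdf.
- by move=> y _; rewrite lee_fin normal_pdf_ge0.
rewrite integral_normal_pdf mule1 lee_fin /C.
have -> : normal_peak (Num.sqrt v) / normal_peak (Num.sqrt v') =
    Num.sqrt (1 - x)^-1.
  rewrite /normal_peak !sqr_sqrtr ?ltW// invrK -sqrtrV; last first.
    by rewrite mulrn_wge0// mulr_ge0 ?pi_ge0// ltW.
  rewrite -sqrtrM; last by rewrite invr_ge0 mulrn_wge0// mulr_ge0 ?pi_ge0// ltW.
  congr Num.sqrt; rewrite /v'; have := pi_gt0 R; move: (pi : R) => p p0.
  by field; rewrite !gt_eqF.
have sq : Num.sqrt (1 - x)^-1 <= expR ((x + 2 * x ^+ 2) / 2).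
  rewrite -(ler_pXn2r (ltn0Sn 1)) ?nnegrE ?sqrtr_ge0 ?expR_ge0//.
  rewrite sqr_sqrtr ?invr_ge0 ?(ltW x1)// -expRM_natr divfK//.
  by apply: inv_onem_le.
apply: (@le_trans _ _ (expR ((x + 2 * x ^+ 2) / 2) * expR (m ^+ 2 * v))).
  apply: ler_pM; rewrite ?sqrtr_ge0 ?expR_ge0// ler_expR -mulrA ler_wpM2l ?sqr_ge0//.
  rewrite ler_pdivrMr// /v' ler_pdivrMr// -mulrA ler_peMr ?(ltW v0)//.
  by rewrite /x; lra.
by rewrite -expRD ler_expR /x; lra.
Qed.

Lemma measurable_quadratic n (l : R) (m : 'I_n -> R) :
  measurable_fun [set: n.-tuple R]
    (fun z => \sum_i (l * tnth z i ^+ 2 + m i * tnth z i)).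
Proof.
apply: measurable_sum => i.
by apply: measurable_funD; apply: measurable_funM => //;
  [apply: measurable_funX|]; exact: measurable_tnth.
Qed.

Lemma measurable_expquad n (l : R) (m : 'I_n -> R) :
  measurable_fun [set: n.-tuple R]
    (fun z => expR (\sum_i (l * tnth z i ^+ 2 + m i * tnth z i))).
Proof. by apply: measurableT_comp => //; exact: measurable_quadratic. Qed.

Lemma iid_exp_moment n (v l : R) (m : 'I_n -> R) : 0 < v -> 2 * l * v <= 2^-1 ->
  (\int[iid (gauss v) n]_z
     (expR (\sum_i (l * tnth z i ^+ 2 + m i * tnth z i)))%:E <=
   (expR (n%:R * (l * v + 4 * l ^+ 2 * v ^+ 2) + v * \sum_i m i ^+ 2))%:E)%E.
Proof.
move=> v0 lv; elim: n m => [|n IH] m.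
  rewrite ge0_integral_iid0; last by apply/measurable_EFinP; exact: measurable_expquad.
  by rewrite !big_ord0 mul0r mulr0 addr0.
rewrite ge0_integral_iidS; last 2 first.
- by apply/measurable_EFinP; exact: measurable_expquad.
- by move=> t; rewrite lee_fin expR_ge0.
pose m' i := m (lift ord0 i).
pose C := expR (n%:R * (l * v + 4 * l ^+ 2 * v ^+ 2) + v * \sum_i m' i ^+ 2).
apply: (@le_trans _ _ (\int[gauss v]_x
  ((expR (l * x ^+ 2 + m ord0 * x))%:E * C%:E))%E).
  apply: ge0_le_integral => //.
  - by move=> x _; apply: integral_ge0 => t _; rewrite lee_fin expR_ge0.
  - apply: (@measurable_iid_inner _ _ _ (gauss v) n
      (fun z => (expR (\sum_i (l * tnth z i ^+ 2 + m i * tnth z i)))%:E)).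
      by apply/measurable_EFinP; exact: measurable_expquad.
    by move=> t; rewrite lee_fin expR_ge0.
  - apply/measurable_EFinP; apply: measurable_funM => //.
    apply: measurableT_comp => //.
    by apply: measurable_funD; apply: measurable_funM => //; exact: measurable_funX.
  move=> x _.
  under eq_integral => t _.
    rewrite big_ord_recl expRD tnth0 EFinM.
    under eq_bigr do rewrite tnthS.
    over.
  rewrite /= ge0_integralZl//; last first.
    by apply/measurable_EFinP; exact: measurable_expquad.
  by apply: lee_wpmul2l; rewrite ?lee_fin ?expR_ge0//; exact: IH.
rewrite ge0_integralZr//; last 2 first.
- apply/measurable_EFinP; apply: measurableT_comp => //.
  by apply: measurable_funD; apply: measurable_funM => //; exact: measurable_funX.
- by rewrite lee_fin expR_ge0.
apply: (@le_trans _ _ ((expR (l * v + 4 * l ^+ 2 * v ^+ 2 + m ord0 ^+ 2 * v))%:E * C%:E)%E).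
  by apply: lee_wpmul2r; rewrite ?lee_fin ?expR_ge0//; exact: gauss_exp_moment.
rewrite -EFinM lee_fin -expRD ler_expR big_ord_recl -(natr1 n) /m'.
by rewrite le_eqVlt; apply/orP; left; apply/eqP; ring.
Qed.

(** Exponential Markov inequality. The tilting parameter is not separate: callers scale [l], [m] and
    [t] by it. *)
Lemma iid_chernoff n (v l t : R) (m : 'I_n -> R) : 0 < v -> 2 * l * v <= 2^-1 ->
  (iid (gauss v) n
     [set z | (t <= \sum_i (l * tnth z i ^+ 2 + m i * tnth z i))%R] <=
   (expR (n%:R * (l * v + 4 * l ^+ 2 * v ^+ 2) + v * (\sum_i m i ^+ 2) - t))%:E)%E.
Proof.
move=> v0 lv.
set f := fun z : n.-tuple R => \sum_i (l * tnth z i ^+ 2 + m i * tnth z i).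
have mf : measurable_fun [set: n.-tuple R] f by exact: measurable_quadratic.
have mA : measurable [set z | t <= f z] by exact: measurable_superlevel.
rewrite -(setIT [set z | t <= f z]) -integral_indic//.
apply: (@le_trans _ _ (\int[iid (gauss v) n]_z ((expR (- t))%:E * (expR (f z))%:E))%E).
  apply: ge0_le_integral => //.
  - by apply/measurable_EFinP.
  - apply/measurable_EFinP; apply: measurable_funM => //.
    exact: measurableT_comp.
  move=> z _; rewrite -EFinM lee_fin -expRD indicE; case: (boolP (_ \in _)).
    rewrite inE/= => tf; apply: (@le_trans _ _ (expR 0)); first by rewrite expR0.
    by rewrite ler_expR addrC subr_ge0.
  by rewrite expR_ge0.
rewrite ge0_integralZl//; last first.
  by apply/measurable_EFinP; exact: measurableT_comp.
rewrite addrC expRD EFinM; apply: lee_wpmul2l; first by rewrite lee_fin expR_ge0.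
exact: iid_exp_moment.
Qed.

End gaussian_moments.

Section change_of_measure.
Context (R : realType).

Definition translate n (c : 'I_n -> R) (z : n.-tuple R) : n.-tuple R :=
  [tuple c i + tnth z i | i < n].

Lemma measurable_translate n (c : 'I_n -> R) :
  measurable_fun [set: n.-tuple R] (translate c).
Proof.
apply: measurable_mktuple => i.
by apply: measurable_funD => //; exact: measurable_tnth.
Qed.

(* Up to the constant n/2 * ln (V / N), the log-likelihood ratio of the output
   c + z between N(c, N)^n and N(0, V)^n. *)
Definition log_ratio n (V N : R) (c : 'I_n -> R) (z : n.-tuple R) : R :=
  \sum_i ((c i + tnth z i) ^+ 2 / (2 * V) - tnth z i ^+ 2 / (2 * N)).

Lemma measurable_log_ratio n (V N : R) (c : 'I_n -> R) :
  measurable_fun [set: n.-tuple R] (log_ratio V N c).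
Proof.
apply: measurable_sum => i.
apply: measurable_funB; apply: measurable_funM => //; apply: measurable_funX.
  by apply: measurable_funD => //; exact: measurable_tnth.
exact: measurable_tnth.
Qed.

(** The exponential replaces the Gaussian weight of variance N at x by that of variance V at
    [c + x]. Translation invariance removes c, and [Num.sqrt (V / N)] is the ratio of the
    normalising constants. *)
Lemma gauss_change_of_measure (V N c : R) (f : R -> \bar R) : 0 < V -> 0 < N ->
  measurable_fun [set: R] f -> (forall x, 0 <= f x)%E ->
  (\int[gauss N]_x
      (f (c + x)%R * (expR (- ((c + x) ^+ 2 / (2 * V) - x ^+ 2 / (2 * N))))%:E) =
   (Num.sqrt (V / N))%:E * \int[gauss V]_x f x)%E.
Proof.
move=> V0 N0 mf f0.
have sV : Num.sqrt V != 0 by rewrite gt_eqF ?sqrtr_gt0.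
have sN : Num.sqrt N != 0 by rewrite gt_eqF ?sqrtr_gt0.
have mfc : measurable_fun [set: R] (fun x => f (c + x)).
  by apply: (measurableT_comp mf); apply: measurable_funD.
have mE : measurable_fun [set: R] (fun x =>
    (expR (- ((c + x) ^+ 2 / (2 * V) - x ^+ 2 / (2 * N))))%:E).
  apply/measurable_EFinP/measurableT_comp => //; apply: measurableT_comp => //.
  apply: measurable_funB; apply: measurable_funM => //; apply: measurable_funX => //.
  exact: measurable_funD.
rewrite [LHS]ge0_integral_gauss; last 2 first.
- exact: emeasurable_funM.
- by move=> x; rewrite mule_ge0// lee_fin expR_ge0.
rewrite ge0_integral_gauss//.
rewrite -ge0_integralZl//; last 2 first.
- apply: emeasurable_funM => //.
  by apply/measurable_EFinP; exact: measurable_normal_pdf.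
- by move=> x _; rewrite mule_ge0// lee_fin normal_pdf_ge0.
rewrite -(@ge0_integral_lebesgue_shift _ c (fun x : R =>
   ((Num.sqrt (V / N))%:E * (f x * (normal_pdf 0 (Num.sqrt V) x)%:E))%E)); last 2 first.
- apply: emeasurable_funM => //; apply: emeasurable_funM => //.
  by apply/measurable_EFinP; exact: measurable_normal_pdf.
- move=> x; rewrite !mule_ge0 ?lee_fin ?sqrtr_ge0//.
  exact: normal_pdf_ge0.
apply: eq_integral => x _.
rewrite muleCA -muleA -!EFinM; congr (_ * _%:E)%E.
rewrite !normal_pdfE// /normal_fun !subr0 !sqr_sqrtr ?ltW//.
have -> : normal_peak (Num.sqrt N) = Num.sqrt (V / N) * normal_peak (Num.sqrt V).
  rewrite /normal_peak !sqr_sqrtr ?ltW// -!sqrtrV ?mulrn_wge0 ?mulr_ge0 ?pi_ge0 ?ltW//.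
  rewrite -sqrtrM ?divr_ge0 ?ltW//; congr Num.sqrt.
  have := pi_gt0 R; move: (pi : R) => p p0.
  by field; rewrite !gt_eqF.
rewrite mulrCA -!mulrA; congr (_ * (_ * _)); rewrite -expRD; congr expR.
by field; rewrite !gt_eqF.
Qed.

Lemma translateS n (c : 'I_n.+1 -> R) (x : R) (z : n.-tuple R) :
  translate c (Defs.cons_tuple (x, z)) =
  Defs.cons_tuple (c ord0 + x, translate (fun i => c (lift ord0 i)) z).
Proof.
apply: eq_from_tnth => i; rewrite tnth_mktuple; have [j ->|->] := unliftP ord0 i.
  by rewrite !tnthS tnth_mktuple.
by rewrite !tnth0.
Qed.

Lemma log_ratioS n (V N : R) (c : 'I_n.+1 -> R) (x : R) (z : n.-tuple R) :
  log_ratio V N c (Defs.cons_tuple (x, z)) =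
  (c ord0 + x) ^+ 2 / (2 * V) - x ^+ 2 / (2 * N) +
  log_ratio V N (fun i => c (lift ord0 i)) z.
Proof.
rewrite /log_ratio big_ord_recl tnth0; congr (_ + _).
by apply: eq_bigr => i _; rewrite tnthS.
Qed.

Lemma iid_change_of_measure n (V N : R) (c : 'I_n -> R) (f : n.-tuple R -> \bar R) :
  0 < V -> 0 < N ->
  measurable_fun [set: n.-tuple R] f -> (forall x, 0 <= f x)%E ->
  (\int[iid (gauss N) n]_z (f (translate c z) * (expR (- log_ratio V N c z))%:E) =
   (Num.sqrt (V / N) ^+ n)%:E * \int[iid (gauss V) n]_y f y)%E.
Proof.
move=> V0 N0.
have mF k (c' : 'I_k -> R) (g : k.-tuple R -> \bar R) :
   measurable_fun [set: k.-tuple R] g ->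
   measurable_fun [set: k.-tuple R]
     (fun z => g (translate c' z) * (expR (- log_ratio V N c' z))%:E)%E.
  move=> mg; apply: emeasurable_funM.
    exact: measurableT_comp mg (@measurable_translate _ _).
  apply/measurable_EFinP/measurableT_comp => //; apply: measurableT_comp => //.
  exact: measurable_log_ratio.
elim: n c f => [|n IH] c f mf f0.
  rewrite [LHS](ge0_integral_iid0 (gauss N) (mF _ c f mf)).
  rewrite [X in _ = (_ * X)%E](ge0_integral_iid0 (gauss V) mf).
  rewrite expr0 mul1e /log_ratio big_ord0 oppr0 expR0 mule1.
  by congr f; apply: eq_from_tnth => -[].
have F0 z : (0 <= f (translate c z) * (expR (- log_ratio V N c z))%:E)%E.
  by rewrite mule_ge0// lee_fin expR_ge0.
rewrite [LHS](ge0_integral_iidS (gauss N) (mF _ c f mf) F0).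
rewrite [X in _ = (_ * X)%E](ge0_integral_iidS (gauss V) mf f0).
have mfx x : measurable_fun [set: n.-tuple R] (fun t => f (Defs.cons_tuple (x, t))).
  apply: measurableT_comp mf _.
  exact: (measurableT_comp (@Defs.measurable_cons_tuple _ _ _) (measurable_pair1 x)).
have mFx : measurable_fun [set: R]
    (fun x => \int[iid (gauss V) n]_t f (Defs.cons_tuple (x, t)))%E.
  exact: measurable_iid_inner.
have Fx0 x : (0 <= \int[iid (gauss V) n]_t f (Defs.cons_tuple (x, t)))%E.
  exact: integral_ge0.
rewrite exprSr EFinM -muleA -(gauss_change_of_measure (c ord0) V0 N0 mFx Fx0).
rewrite -ge0_integralZl//; last 2 first.
- apply: emeasurable_funM => //.
    by apply: (measurableT_comp mFx); apply: measurable_funD.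
  apply/measurable_EFinP/measurableT_comp => //; apply: measurableT_comp => //.
  apply: measurable_funB; apply: measurable_funM => //; apply: measurable_funX => //.
  exact: measurable_funD.
- by move=> x _; rewrite mule_ge0// lee_fin expR_ge0.
apply: eq_integral => x _.
pose g t := f (Defs.cons_tuple (c ord0 + x, t)).
pose c' (i : 'I_n) := c (lift ord0 i).
transitivity (\int[iid (gauss N) n]_t
  (g (translate c' t) * (expR (- log_ratio V N c' t))%:E *
    (expR (- ((c ord0 + x) ^+ 2 / (2 * V) - x ^+ 2 / (2 * N))))%:E))%E.
  apply: eq_integral => t _.
  by rewrite translateS log_ratioS opprD expRD mulrC EFinM muleA.
rewrite [LHS]ge0_integralZr//; last 2 first.
- exact: (mF n c' g (mfx _)).
- by move=> t _; apply: mule_ge0; [exact: f0 | rewrite lee_fin expR_ge0].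
have E := IH c' g (mfx _) (fun t => f0 _).
rewrite [RHS]muleA; exact: (congr1 (fun y => (y * _)%E) E).
Qed.

(** Threshold argument of hypothesis testing: where the log-likelihood ratio is below g, the
    indicator of D costs at most a factor [expR g] after the change of measure; elsewhere it is
    bounded by 1 and charged to the tail event. *)
Lemma iid_translate_le n (V N g : R) (c : 'I_n -> R) (D : set (n.-tuple R)) :
  0 < V -> 0 < N -> measurable D ->
  (iid (gauss N) n (translate c @^-1` D) <=
   (expR g * Num.sqrt (V / N) ^+ n)%:E * iid (gauss V) n D +
   iid (gauss N) n [set z | (g <= log_ratio V N c z)%R])%E.
Proof.
move=> V0 N0 mD.
set B := [set z | _].
have mlr := @measurable_log_ratio n V N c.
have mB : measurable B by exact: measurable_superlevel.
have mA : measurable (translate c @^-1` D).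
  by rewrite -[X in measurable X]setTI; exact: measurable_translate.
have mI : measurable_fun [set: n.-tuple R] (fun y => (\1_D y)%:E : \bar R).
  by apply/measurable_EFinP; exact: measurable_indic.
have mIt : measurable_fun [set: n.-tuple R] (fun z =>
    (\1_D (translate c z))%:E * (expR (- log_ratio V N c z))%:E : \bar R)%E.
  apply: emeasurable_funM.
    exact: measurableT_comp mI (@measurable_translate _ _).
  apply/measurable_EFinP/measurableT_comp => //; exact: measurableT_comp.
have It0 z : (0 <= (\1_D (translate c z))%:E * (expR (- log_ratio V N c z))%:E :> \bar R)%E.
  by rewrite mule_ge0 ?lee_fin ?expR_ge0.
have I0 y : (0 <= (\1_D y)%:E :> \bar R)%E by rewrite lee_fin.
have E := iid_change_of_measure c V0 N0 mI I0.
have DE : (\int[iid (gauss V) n]_y (\1_D y)%:E = iid (gauss V) n D)%E.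
  by rewrite integral_indic// setIT.
have BE : (\int[iid (gauss N) n]_y (\1_B y)%:E = iid (gauss N) n B)%E.
  by rewrite integral_indic// setIT.
have AE : (\int[iid (gauss N) n]_y (\1_(translate c @^-1` D) y)%:E =
    iid (gauss N) n (translate c @^-1` D))%E.
  by rewrite integral_indic// setIT.
rewrite [X in _ = (_ * X)%E]DE in E.
rewrite EFinM -(muleA (expR g)%:E).
rewrite -[X in (_ * X + _)%E]E -[X in (_ <= _ + X)%E]BE -[X in (X <= _)%E]AE.
have mBI : measurable_fun [set: n.-tuple R] (fun y => (\1_B y)%:E : \bar R).
  by apply/measurable_EFinP; exact: measurable_indic.
have gI0 z : (0 <= (expR g)%:E *
    ((\1_D (translate c z))%:E * (expR (- log_ratio V N c z))%:E))%E.
  by rewrite mule_ge0 ?lee_fin ?expR_ge0.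
have mgI : measurable_fun [set: n.-tuple R] (fun z => (expR g)%:E *
    ((\1_D (translate c z))%:E * (expR (- log_ratio V N c z))%:E))%E.
  exact: emeasurable_funM.
apply: (@le_trans _ _ (\int[iid (gauss N) n]_z ((expR g)%:E *
    ((\1_D (translate c z))%:E * (expR (- log_ratio V N c z))%:E) + (\1_B z)%:E))%E);
  last first.
  rewrite [leLHS]ge0_integralD// [X in (X + _ <= _)%E]ge0_integralZl//.
apply: ge0_le_integral => //.
- by apply/measurable_EFinP; exact: measurable_indic.
- exact: emeasurable_funD.
move=> z _; rewrite -!EFinM -EFinD lee_fin !indicE.
have -> : (z \in translate c @^-1` D) = (translate c z \in D) by [].
case: (_ \in D); last by rewrite mul0r mulr0 add0r.
rewrite mul1r -expRD; case: (boolP (z \in B)) => [_|].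
  by rewrite lerDr expR_ge0.
rewrite notin_setE /B/= => /negP; rewrite -ltNge => /ltW gz.
rewrite addr0; apply: (@le_trans _ _ (expR 0)); first by rewrite expR0.
by rewrite ler_expR subr_ge0.
Qed.

(** The mean of [log_ratio] is (|c|^2 + n N) / (2 V) - n / 2, at most n d / (2 V) under the energy
    bound with V = P + N. The threshold n d / V is thus linearly above the mean, and [iid_chernoff]
    applies uniformly in c. *)
Lemma iid_log_ratio_tail (P N d : R) : 0 < P -> 0 < N -> 0 < d ->
  exists2 e : R, 0 < e & forall n (c : 'I_n -> R),
    \sum_i c i ^+ 2 <= n%:R * (P + d) ->
    (iid (gauss N) n
       [set z | (n%:R * (d / (P + N)) <= log_ratio (P + N) N c z)%R] <=
     (expR (- (n%:R * e)))%:E)%E.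
Proof.
move=> P0 N0 d0; set V := P + N.
have V0 : 0 < V by rewrite addr_gt0.
(* [K] bounds the second-order coefficient per symbol, so the exponent gained is th d / (2 V) - th^2
   K. Its maximiser is the [th] below, and the maximum is th d / (4 V). *)
pose K := (P ^+ 2 + N * (P + d)) / V ^+ 2.
have K0 : 0 < K.
  by rewrite divr_gt0 ?exprn_gt0// addr_gt0 ?exprn_gt0// mulr_gt0// addr_gt0.
pose th := d / (4 * V * K).
have th0 : 0 < th by exact: divr_gt0 d0 (mulr_gt0 (mulr_gt0 (ltr0Sn _ 3) V0) K0).
have e0 : 0 < th * d / (4 * V) by exact: divr_gt0 (mulr_gt0 th0 d0) (mulr_gt0 (ltr0Sn _ 3) V0).
exists (th * d / (4 * V)) => //.
move=> n c cP.
(* [l] and [m] are th times the coefficients of z^2 and z in [log_ratio]; the part independent of z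
   is moved into [t]. Since [l * N] is negative, the side condition of the Chernoff bound holds. *)
pose l := th * ((2 * V)^-1 - (2 * N)^-1).
pose m i := th * (c i / V).
pose t := th * (n%:R * (d / V)) - th * (\sum_i c i ^+ 2 / (2 * V)).
have lN : l * N = - (th * P / (2 * V)).
  by rewrite /l /V; field; rewrite !gt_eqF.
have sub : [set z | n%:R * (d / V) <= log_ratio V N c z] `<=`
   [set z | t <= \sum_i (l * tnth z i ^+ 2 + m i * tnth z i)].
  move=> z /=; rewrite -(ler_pM2l th0) /t lerBlDr => /le_trans; apply.
  rewrite le_eqVlt; apply/orP; left; apply/eqP.
  rewrite /log_ratio !mulr_sumr -big_split/=; apply: eq_bigr => i _.
  by rewrite /l /m; field; rewrite !gt_eqF.
apply: (@le_trans _ _ (iid (gauss N) n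
   [set z | (t <= \sum_i (l * tnth z i ^+ 2 + m i * tnth z i))%R])).
  apply: le_measure => //; rewrite inE.
    by apply: measurable_superlevel; exact: measurable_log_ratio.
  by apply: measurable_superlevel; exact: measurable_quadratic.
apply: le_trans (iid_chernoff _ _ N0 _) _.
  have q0 : 0 < th * P / (2 * V).
    exact: divr_gt0 (mulr_gt0 th0 P0) (mulr_gt0 (ltr0Sn _ 1) V0).
  by rewrite -mulrA lN; lra.
rewrite lee_fin ler_expR.
have -> : \sum_i m i ^+ 2 = th ^+ 2 / V ^+ 2 * \sum_i c i ^+ 2.
  by rewrite mulr_sumr; apply: eq_bigr => i _; rewrite /m; field; rewrite gt_eqF.
rewrite /t -mulr_suml; move: (\sum_i _) cP => S cP.
have -> : 4 * l ^+ 2 * N ^+ 2 = 4 * (l * N) ^+ 2 by ring.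
rewrite lN.
rewrite -subr_ge0.
have -> : - (n%:R * (th * d / (4 * V))) -
   (n%:R * (- (th * P / (2 * V)) + 4 * (- (th * P / (2 * V))) ^+ 2) +
    N * (th ^+ 2 / V ^+ 2 * S) - (th * (n%:R * (d / V)) - th * (S / (2 * V)))) =
   (n%:R * (P + d) - S) * (th / (2 * V) + N * th ^+ 2 / V ^+ 2) +
   n%:R * th * (d / (4 * V) - th * K).
  by rewrite /K; field; rewrite gt_eqF.
have -> : d / (4 * V) - th * K = 0 by rewrite /th; field; rewrite !gt_eqF.
rewrite mulr0 addr0 mulr_ge0 ?subr_ge0// ltW// addr_gt0//.
  exact: divr_gt0 th0 (mulr_gt0 (ltr0Sn _ 1) V0).
by rewrite divr_gt0 ?exprn_gt0// mulr_gt0 ?exprn_gt0.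
Qed.

End change_of_measure.

Lemma sume_cst (R : realType) (I : finType) (r : \bar R) : (0 <= r)%E ->
  (\sum_(i : I) r = #|I|%:R%:E * r)%E.
Proof.
move=> r0; rewrite big_const.
elim: #|I| => [|k IH]; first by rewrite mul0e.
by rewrite iterS IH -natr1 EFinD ge0_muleDl ?lee_fin// mul1e addeC.
Qed.

(** * Converse *)

Section code_facts.
Context (R : realType).

Lemma measurable_rcons_tuple d (T : measurableType d) n (f : T -> R)
    (g : T -> n.-tuple R) :
  measurable_fun [set: T] f -> measurable_fun [set: T] g ->
  measurable_fun [set: T] (fun t => [tuple of rcons (g t) (f t)]).
Proof.
move=> mf mg; apply/measurable_fun_tnthP => i.
have [lt_in|] := ltnP i n.
  apply: (eq_measurable_fun (fun t => tnth (g t) (Ordinal lt_in))).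
    by move=> t _; rewrite /= !(tnth_nth 0)/= nth_rcons size_tuple lt_in.
  exact: measurableT_comp (@measurable_tnth _ _ _ _) mg.
move=> le_ni; apply: (eq_measurable_fun f) => // t _.
rewrite /= (tnth_nth 0)/= nth_rcons size_tuple ltnNge le_ni/=.
by rewrite eqn_leq le_ni -ltnS ltn_ord.
Qed.

Variables (n M1 M2 : nat) (C : Defs.code R n M1 M2).

Lemma measurable_inputs w1 w2 k : (k <= n)%N ->
  measurable_fun [set: n.-tuple R] (fun s => (inputs C w1 w2 s k).1) /\
  measurable_fun [set: n.-tuple R] (fun s => (inputs C w1 w2 s k).2).
Proof.
elim: k => [_|k IH kn]/=; first by split; exact: measurable_cst.
have [m1 m2] := IH (ltnW kn); split.
- apply: (eq_measurable_fun (fun s => [tuple of rcons (inputs C w1 w2 s k).1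
    (enc1 C w1 s (inputs C w1 w2 s k).2)])).
    by move=> s _; case: inputs.
  apply: measurable_rcons_tuple => //.
  exact: (measurableT_comp (measurable_enc1 C w1 kn) (measurable_fun_pair (@measurable_id _ _ _) m2)).
- apply: (eq_measurable_fun (fun s => [tuple of rcons (inputs C w1 w2 s k).2
    (enc2 C w2 s (inputs C w1 w2 s k).1)])).
    by move=> s _; case: inputs.
  apply: measurable_rcons_tuple => //.
  exact: (measurableT_comp (measurable_enc2 C w2 kn) (measurable_fun_pair (@measurable_id _ _ _) m1)).
Qed.

Lemma measurable_input1 w1 w2 (i : 'I_n) :
  measurable_fun [set: n.-tuple R] (fun s => tnth (input1 C w1 w2 s) i).
Proof.
exact: measurableT_comp (@measurable_tnth _ _ _ _) (measurable_inputs w1 w2 (leqnn n)).1.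
Qed.

Lemma measurable_input2 w1 w2 (i : 'I_n) :
  measurable_fun [set: n.-tuple R] (fun s => tnth (input2 C w1 w2 s) i).
Proof.
exact: measurableT_comp (@measurable_tnth _ _ _ _) (measurable_inputs w1 w2 (leqnn n)).2.
Qed.

Lemma measurable_output w1 w2 :
  measurable_fun [set: n.-tuple R * n.-tuple R]
    (fun sz => output C w1 w2 sz.1 sz.2).
Proof.
apply: measurable_mktuple => i.
apply: measurable_funD.
  apply: measurable_funD; last exact: measurableT_comp (@measurable_tnth _ _ _ _) measurable_fst.
  apply: measurable_funD.
    exact: measurableT_comp (measurable_input1 w1 w2 i) measurable_fst.
  exact: measurableT_comp (measurable_input2 w1 w2 i) measurable_fst.
exact: measurableT_comp (@measurable_tnth _ _ _ _) measurable_snd.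
Qed.

Lemma measurable_decoded w1 w2 w :
  measurable [set sz | dec C (output C w1 w2 sz.1 sz.2) = w].
Proof.
have -> : [set sz | dec C (output C w1 w2 sz.1 sz.2) = w] =
  (fun sz => output C w1 w2 sz.1 sz.2) @^-1` (dec C @^-1` [set w]) by [].
rewrite -[X in measurable X]setTI; apply: measurable_output => //.
exact: measurable_dec.
Qed.

Lemma measurable_error w1 w2 w :
  measurable [set sz | dec C (output C w1 w2 sz.1 sz.2) <> w].
Proof. exact: measurableC (measurable_decoded w1 w2 w). Qed.

Lemma msg_meanE (F : 'I_M1 -> 'I_M2 -> \bar R) :
  msg_mean F = ((M1 * M2)%:R^-1%:E * \sum_(w : 'I_M1 * 'I_M2) F w.1 w.2)%E.
Proof. by rewrite /msg_mean pair_bigA. Qed.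

Lemma sum_msg_cst (r : \bar R) : (0 <= r)%E ->
  ((M1 * M2)%:R^-1%:E * \sum_(w : 'I_M1 * 'I_M2) r = r)%E.
Proof.
move=> r0.
have M0 : (0 < M1 * M2)%N by rewrite muln_gt0 (M1_gt0 C) (M2_gt0 C).
have M0' : (M1 * M2)%:R != 0 :> R by rewrite pnatr_eq0 -lt0n.
rewrite sume_cst// card_prod !card_ord.
by rewrite muleA -EFinM mulVf// mul1e.
Qed.

Lemma mean_powerE (X : 'I_M1 -> 'I_M2 -> n.-tuple R -> n.-tuple R) Q0 :
  (forall w1 w2 i, measurable_fun [set: n.-tuple R] (fun s => tnth (X w1 w2 s) i)) ->
  mean_power Q0 X = ((n%:R^-1%:E) * ((M1 * M2)%:R^-1%:E * \sum_(w : 'I_M1 * 'I_M2)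
    \int[state_law n Q0]_s (\sum_i (tnth (X w.1 w.2 s) i) ^+ 2)%:E))%E.
Proof.
move=> mX; rewrite /mean_power; congr (_ * _)%E.
under eq_bigr do rewrite msg_meanE.
rewrite -ge0_sume_distrr => [|i _]; last first.
  by apply: sume_ge0 => w _; apply: expectation_ge0 => s; exact: sqr_ge0.
congr (_ * _)%E; rewrite exchange_big/=; apply: eq_bigr => w _.
under [in RHS]eq_integral do rewrite -sumEFin.
rewrite ge0_integral_sum//=.
- by apply: eq_bigr => i _; rewrite unlock.
- move=> i; apply/measurable_EFinP; exact: measurable_funX.
- by move=> i s _; rewrite lee_fin sqr_ge0.
Qed.

End code_facts.

Section converse.
Context (R : realType).
Variables (P1 P2 Q0 N d : R).
Hypotheses (P1_gt0 : 0 < P1) (P2_gt0 : 0 < P2) (N_gt0 : 0 < N).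
Hypothesis d_gt0 : 0 < d.
Let P := (Num.sqrt P1 + Num.sqrt P2) ^+ 2.
Let V := P + N.

Let q1_gt0 : 0 < Num.sqrt P1. Proof. by rewrite sqrtr_gt0. Qed.
Let q2_gt0 : 0 < Num.sqrt P2. Proof. by rewrite sqrtr_gt0. Qed.
Let P_gt0 : 0 < P. Proof. by rewrite exprn_gt0// addr_gt0. Qed.
Let V_gt0 : 0 < V. Proof. by rewrite addr_gt0. Qed.

(* The weights are chosen so that the right-hand side has mean at most P when x
   and y have powers P1 and P2. *)
Lemma sum_sqr_le (x y : R) : (x + y) ^+ 2 <=
  (Num.sqrt P1 + Num.sqrt P2) / Num.sqrt P1 * x ^+ 2 +
  (Num.sqrt P1 + Num.sqrt P2) / Num.sqrt P2 * y ^+ 2.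
Proof.
move: (Num.sqrt P1) (Num.sqrt P2) q1_gt0 q2_gt0 => a b a0 b0.
rewrite -subr_ge0.
have -> : (a + b) / a * x ^+ 2 + (a + b) / b * y ^+ 2 - (x + y) ^+ 2 =
   (b * x - a * y) ^+ 2 / (a * b) by field; rewrite !gt_eqF.
by rewrite divr_ge0 ?sqr_ge0// mulr_ge0 ?ltW.
Qed.

Section one_code.
Variables (n M1 M2 : nat) (C : Defs.code R n M1 M2).
Hypothesis n_gt0 : (0 < n)%N.
Local Notation sigma := (state_law n Q0).
Local Notation nu := (noise_law n N).
Local Notation msg := ('I_M1 * 'I_M2)%type.

Let c (w : msg) (s : n.-tuple R) i :=
  tnth (input1 C w.1 w.2 s) i + tnth (input2 C w.1 w.2 s) i.
Let S (w : msg) := [set sz | dec C (output C w.1 w.2 sz.1 sz.2) = w].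
(* Correct decoding when the output minus the state is replaced by a variable
   sz.2 that is independent of the messages. *)
Let G (w : msg) := [set sz : n.-tuple R * n.-tuple R |
  dec C (translate (tnth sz.1) sz.2) = w].

Let measurable_c w i : measurable_fun [set: n.-tuple R] (c w ^~ i).
Proof.
by apply: measurable_funD; [exact: measurable_input1|exact: measurable_input2].
Qed.

Let measurable_energy w :
  measurable_fun [set: n.-tuple R] (fun s => (\sum_i c w s i ^+ 2)%:E).
Proof.
apply/measurable_EFinP; apply: measurable_sum => i.
by apply: measurable_funX; exact: measurable_c.
Qed.

Let measurable_G w : measurable (G w).
Proof.
have -> : G w = (fun sz => translate (tnth sz.1) sz.2) @^-1` (dec C @^-1` [set w]).
  by [].
rewrite -[X in measurable X]setTI; apply: measurable_mktuple => //.
  move=> i; apply: measurable_funD.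
    exact: measurableT_comp (@measurable_tnth _ _ _ _) measurable_fst.
  exact: measurableT_comp (@measurable_tnth _ _ _ _) measurable_snd.
exact: measurable_dec.
Qed.

(** For each state the decision regions partition the space, and the law does not depend on w. This
    is how the number of messages enters: the mean success probability under this law is 1 / (M1
    M2). *)
Lemma sum_genie_law : (\sum_w (sigma \x iid (gauss V) n) (G w) = 1)%E.
Proof.
transitivity (\sum_w \int[sigma \x iid (gauss V) n]_sz (\1_(G w) sz)%:E)%E.
  by apply: eq_bigr => w _; rewrite integral_indic// setIT.
rewrite -ge0_integral_sum//; last first.
  by move=> w; apply/measurable_EFinP; exact: measurable_indic.
transitivity (\int[sigma \x iid (gauss V) n]_sz 1)%E.
  apply: eq_integral => sz _; rewrite sumEFin.
  rewrite (bigD1 (dec C (translate (tnth sz.1) sz.2)))//= big1 ?addr0.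
    by rewrite indicE mem_set.
  move=> w /eqP ww; rewrite indicE memNset//= /G/= => E.
  by apply: ww.
by rewrite integral_cst// mul1e; exact: probability_setT.
Qed.

(** The inputs may be fully correlated, so the cross term is bounded by [sum_sqr_le] before
    averaging; the weights satisfy a1 P1 + a2 P2 = P. *)
Lemma mean_energy_le : power_constraint C Q0 P1 P2 ->
  ((M1 * M2)%:R^-1%:E * \sum_w \int[sigma]_s (\sum_i c w s i ^+ 2)%:E <=
   (n%:R * P)%:E)%E.
Proof.
pose T1 := ((M1 * M2)%:R^-1%:E * \sum_(w : msg)
  \int[sigma]_s (\sum_i tnth (input1 C w.1 w.2 s) i ^+ 2)%:E)%E.
pose T2 := ((M1 * M2)%:R^-1%:E * \sum_(w : msg)
  \int[sigma]_s (\sum_i tnth (input2 C w.1 w.2 s) i ^+ 2)%:E)%E.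
have n0 : n%:R != 0 :> R by rewrite pnatr_eq0 -lt0n.
have scale (T : \bar R) p : (n%:R^-1%:E * T <= p%:E -> T <= (n%:R * p)%:E)%E.
  move=> Tp; have -> : (T = n%:R%:E * (n%:R^-1%:E * T))%E.
    by rewrite muleA -EFinM mulfV// mul1e.
  by rewrite EFinM; apply: lee_wpmul2l => //; rewrite lee_fin.
case; rewrite mean_powerE//; last exact: measurable_input1.
rewrite mean_powerE//; last exact: measurable_input2.
move=> /scale T1le /scale T2le.
pose a1 := (Num.sqrt P1 + Num.sqrt P2) / Num.sqrt P1.
pose a2 := (Num.sqrt P1 + Num.sqrt P2) / Num.sqrt P2.
have a10 : 0 <= a1 by rewrite divr_ge0 ?addr_ge0 ?ltW.
have a20 : 0 <= a2 by rewrite divr_ge0 ?addr_ge0 ?ltW.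
have mx1 w : measurable_fun [set: n.-tuple R]
    (fun s => (\sum_i tnth (input1 C w.1 w.2 s) i ^+ 2)%:E).
  apply/measurable_EFinP; apply: measurable_sum => i.
  by apply: measurable_funX; exact: measurable_input1.
have mx2 w : measurable_fun [set: n.-tuple R]
    (fun s => (\sum_i tnth (input2 C w.1 w.2 s) i ^+ 2)%:E).
  apply/measurable_EFinP; apply: measurable_sum => i.
  by apply: measurable_funX; exact: measurable_input2.
have ss0 (x : 'I_n -> R) : (0 <= (\sum_i x i ^+ 2)%:E)%E.
  by rewrite lee_fin sumr_ge0// => i _; exact: sqr_ge0.
have I0 (f : n.-tuple R -> 'I_n -> R) : (0 <= \int[sigma]_s (\sum_i f s i ^+ 2)%:E)%E.
  by apply: integral_ge0 => s _.
have Mge0 : (0 <= (M1 * M2)%:R^-1%:E :> \bar R)%E by rewrite lee_fin invr_ge0.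
apply: (@le_trans _ _ (a1%:E * T1 + a2%:E * T2)%E).
  rewrite /T1 /T2 (muleCA a1%:E) (muleCA a2%:E) -ge0_muleDr; last 2 first.
  - by apply: mule_ge0; rewrite ?lee_fin//; apply: sume_ge0 => w _; exact: I0.
  - by apply: mule_ge0; rewrite ?lee_fin//; apply: sume_ge0 => w _; exact: I0.
  apply: lee_wpmul2l => //.
  rewrite !ge0_sume_distrr => [|w _|w _]; [|exact: I0|exact: I0].
  rewrite -big_split/=; apply: lee_sum => w _.
  rewrite -!ge0_integralZl//; [|by rewrite lee_fin..].
  rewrite -ge0_integralD//; last 4 first.
  - by move=> s _; rewrite mule_ge0// lee_fin.
  - exact: emeasurable_funM.
  - by move=> s _; rewrite mule_ge0// lee_fin.
  - exact: emeasurable_funM.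
  apply: ge0_le_integral => //.
  - by apply: emeasurable_funD; exact: emeasurable_funM.
  move=> s _; rewrite -!EFinM -EFinD lee_fin !mulr_sumr -big_split/=.
  by apply: ler_sum => i _; exact: sum_sqr_le.
apply: (@le_trans _ _ (a1%:E * (n%:R * P1)%:E + a2%:E * (n%:R * P2)%:E)%E).
  by apply: leeD; apply: lee_wpmul2l; rewrite ?lee_fin.
rewrite -!EFinM -EFinD lee_fin /a1 /a2 /P.
rewrite le_eqVlt; apply/orP; left; apply/eqP.
have := sqr_sqrtr (ltW P2_gt0); have := sqr_sqrtr (ltW P1_gt0).
move: (Num.sqrt P1) (Num.sqrt P2) q1_gt0 q2_gt0 => a b a0 b0 <- <-.
by field; rewrite !gt_eqF.
Qed.

Let measurable_S w : measurable (S w).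
Proof. exact: measurable_decoded. Qed.

(** Given the state, the input for w is a fixed vector. The three terms pay for an energy above n (P
    + d), for an atypical log-likelihood ratio, and for decoding under the law of variance V. *)
Lemma success_le e w :
  (forall c : 'I_n -> R, \sum_i c i ^+ 2 <= n%:R * (P + d) ->
    (iid (gauss N) n
       [set z | (n%:R * (d / V) <= log_ratio V N c z)%R] <=
     (expR (- (n%:R * e)))%:E)%E) ->
  ((sigma \x nu) (S w) <=
   (n%:R * (P + d))^-1%:E * (\int[sigma]_s (\sum_i c w s i ^+ 2)%:E) +
   (expR (- (n%:R * e)))%:E +
   (expR (n%:R * (d / V)) * Num.sqrt (V / N) ^+ n)%:E *
     (sigma \x iid (gauss V) n) (G w))%E.
Proof.
move=> tail.
set a := (n%:R * (P + d))^-1; set K := expR _ * _.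
have nPd : 0 < n%:R * (P + d) by rewrite mulr_gt0 ?ltr0n// addr_gt0.
have a0 : 0 <= a by rewrite invr_ge0 ltW.
have K0 : 0 <= K by rewrite mulr_ge0 ?expR_ge0 ?exprn_ge0 ?sqrtr_ge0.
have mGx : measurable_fun [set: n.-tuple R]
    (fun s => iid (gauss V) n (xsection (G w) s)).
  exact: measurable_fun_xsection.
have E0 s : (0 <= (\sum_i c w s i ^+ 2)%:E)%E.
  by rewrite lee_fin sumr_ge0// => i _; exact: sqr_ge0.
have -> : ((sigma \x nu) (S w) = \int[sigma]_s nu (xsection (S w) s))%E by [].
have -> : ((sigma \x iid (gauss V) n) (G w) =
    \int[sigma]_s iid (gauss V) n (xsection (G w) s))%E by [].
apply: (@le_trans _ _ (\int[sigma]_s (a%:E * (\sum_i c w s i ^+ 2)%:E +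
    (expR (- (n%:R * e)))%:E + K%:E * iid (gauss V) n (xsection (G w) s)))%E).
  apply: ge0_le_integral => //.
  - exact: measurable_fun_xsection.
  - apply: emeasurable_funD; last exact: emeasurable_funM.
    by apply: emeasurable_funD => //; exact: emeasurable_funM.
  move=> s _.
  pose D := [set y | dec C (translate (tnth s) y) = w].
  have mD : measurable D.
    have -> : D = xsection (G w) s by rewrite /xsection; apply/seteqP; split=> y; rewrite /= inE.
    exact: measurable_xsection.
  have -> : xsection (G w) s = D.
    by rewrite /xsection; apply/seteqP; split=> y; rewrite /= inE.
  have -> : xsection (S w) s = translate (c w s) @^-1` D.
    have out y : output C w.1 w.2 s y = translate (tnth s) (translate (c w s) y).
      by apply: eq_from_tnth => i; rewrite !tnth_mktuple /c; ring.
    by rewrite /xsection; apply/seteqP; split=> y; rewrite /= inE /S /D/= out.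
  have K1 : (0 <= K%:E * iid (gauss V) n D)%E by rewrite mule_ge0.
  (* Above the power threshold, the first term alone is at least 1 (Markov). *)
  have [cP|cP] := leP (\sum_i c w s i ^+ 2) (n%:R * (P + d)).
    apply: le_trans (iid_translate_le (n%:R * (d / V)) (c w s) V_gt0 N_gt0 mD) _.
    rewrite addeC; apply: leeD => //; apply: le_trans (tail _ cP) _.
    by apply: leeDr; rewrite mule_ge0// lee_fin.
  apply: (@le_trans _ _ 1%E); first apply: probability_le1.
    by rewrite -[X in measurable X]setTI; exact: measurable_translate.
  apply: (@le_trans _ _ (a%:E * (\sum_i c w s i ^+ 2)%:E)%E).
    by rewrite -EFinM lee_fin /a mulrC ler_pdivlMr// mul1r ltW.
  by rewrite -addeA; apply: leeDl; apply: adde_ge0 => //; rewrite lee_fin expR_ge0.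
have aE0 s : (0 <= a%:E * (\sum_i c w s i ^+ 2)%:E)%E by apply: mule_ge0.
have e1 : (0 <= (expR (- (n%:R * e)))%:E :> \bar R)%E by rewrite lee_fin expR_ge0.
rewrite ge0_integralD//; last 4 first.
- by move=> s _; exact: adde_ge0.
- by apply: emeasurable_funD => //; exact: emeasurable_funM.
- by move=> s _; exact: mule_ge0.
- exact: emeasurable_funM.
rewrite ge0_integralD//; last first.
  exact: emeasurable_funM.
rewrite integral_cst//= [X in (_ * X)%E]probability_setT mule1.
rewrite !ge0_integralZl//.
Qed.

End one_code.

(** Average of [success_le] over the messages, with [mean_energy_le] for the first term and
    [sum_genie_law] for the last. The exponent e depends on neither the code nor its length. *)
Lemma converse_bound : exists2 e, 0 < e & forall n M1 M2 (C : Defs.code R n M1 M2),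
  (0 < n)%N -> power_constraint C Q0 P1 P2 ->
  (1 <= error_prob C Q0 N + (P / (P + d) + expR (- (n%:R * e)) +
      expR (n%:R * (d / V)) * Num.sqrt (V / N) ^+ n / (M1 * M2)%:R)%:E)%E.
Proof.
have [e e0 tail] := iid_log_ratio_tail P_gt0 N_gt0 d_gt0.
exists e => // n M1 M2 C n0 pow.
set K := expR (n%:R * (d / V)) * _.
have Mge0 : (0 <= (M1 * M2)%:R^-1%:E :> \bar R)%E by rewrite lee_fin invr_ge0.
have K0 : 0 <= K by rewrite mulr_ge0 ?expR_ge0 ?exprn_ge0 ?sqrtr_ge0.
have Pd0 : 0 < P + d by rewrite addr_gt0.
rewrite -[leLHS](sum_msg_cst C (@lee01 R)) /error_prob msg_meanE.
pose T (w : 'I_M1 * 'I_M2) : \bar R :=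
  ((n%:R * (P + d))^-1%:E * (\int[state_law n Q0]_s (\sum_i (tnth (input1 C w.1 w.2 s) i + tnth (input2 C w.1 w.2 s) i) ^+ 2)%:E) +
   (expR (- (n%:R * e)))%:E +
   K%:E * (state_law n Q0 \x iid (gauss V) n) [set sz : n.-tuple R * n.-tuple R |
      dec C (translate (tnth sz.1) sz.2) = w])%E.
have I0 w : (0 <= \int[state_law n Q0]_s (\sum_i (tnth (input1 C w.1 w.2 s) i + tnth (input2 C w.1 w.2 s) i) ^+ 2)%:E)%E.
  by apply: integral_ge0 => s _; rewrite lee_fin sumr_ge0// => i _; exact: sqr_ge0.
have T0 w : (0 <= T w)%E.
  by rewrite !adde_ge0 ?mule_ge0 ?lee_fin ?expR_ge0 ?invr_ge0 ?mulr_ge0 ?(ltW Pd0).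
apply: (@le_trans _ _ ((M1 * M2)%:R^-1%:E * \sum_(w : 'I_M1 * 'I_M2)
   ((state_law n Q0 \x noise_law n N)
      [set sz | dec C (output C w.1 w.2 sz.1 sz.2) <> (w.1, w.2)] + T w))%E).
  (* For each message pair, error and success have total probability 1, so the bound [T] on success
     yields 1 <= error + [T]. *)
  apply: lee_wpmul2l => //; apply: lee_sum => -[w1 w2] _.
  set E := [set sz | _ <> _].
  have ES : E = ~` [set sz | dec C (output C w1 w2 sz.1 sz.2) = (w1, w2)] by [].
  have mS := measurable_decoded C w1 w2 (w1, w2).
  have := success_le C n0 (w1, w2) (tail n).
  move=> /(leeD2l ((state_law n Q0 \x noise_law n N)%E E)); apply: le_trans.
  rewrite ES probability_setC// subeK//.
  by rewrite fin_num_measure.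
rewrite big_split/= ge0_muleDr; last 2 first.
- exact: sume_ge0.
- exact: sume_ge0.
apply: leeD => //.
rewrite /T !big_split/= -!ge0_sume_distrr//.
rewrite !ge0_muleDr; [|by rewrite ?adde_ge0 ?mule_ge0 ?sume_ge0 ?lee_fin ?expR_ge0 ?invr_ge0 ?mulr_ge0 ?(ltW Pd0)..].
rewrite (sum_msg_cst C) ?lee_fin ?expR_ge0//.
rewrite (sum_genie_law C) mule1.
rewrite 2!EFinD; apply: leeD; last by rewrite -EFinM mulrC.
apply: leeD => //.
rewrite muleCA; apply: le_trans (lee_wpmul2l _ (mean_energy_le n0 pow)) _.
  by rewrite lee_fin invr_ge0 mulr_ge0// ltW.
rewrite -EFinM lee_fin le_eqVlt; apply/orP; left; apply/eqP; field.
by rewrite pnatr_eq0 -lt0n n0 gt_eqF.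
Qed.

End converse.

(** * Rates, message counts and the limit in the converse *)

Section converse_limit.
Context (R : realType).

Lemma powR2E (x : R) : 2 `^ x = expR (x * ln 2).
Proof. by rewrite /powR gt_eqF. Qed.

Lemma num_msg_gt0 (r : R) n : 0 <= r -> (0 < num_msg r n)%N.
Proof.
move=> r0; rewrite /num_msg truncn_gt0 powR2E -[leLHS]expR0 ler_expR.
by apply: mulr_ge0; [exact: mulr_ge0|apply: ln_ge0; rewrite ler1n].
Qed.

Lemma num_msg_le (r : R) n : (num_msg r n)%:R <= expR (n%:R * (r * ln 2)).
Proof. by rewrite /num_msg powR2E mulrA truncn_le// expR_ge0. Qed.

(** Truncating a real that is at least 1 loses at most a factor 2. *)
Lemma num_msg_ge (r : R) n : 0 <= r ->
  expR (n%:R * (r * ln 2)) / 2 <= (num_msg r n)%:R.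
Proof.
move=> r0; have := num_msg_gt0 n r0; rewrite -(ler1n R).
have := truncnS_gt (2 `^ (n%:R * r)); rewrite -/(num_msg r n) powR2E -mulrA -(natr1 (num_msg r n)).
by move=> *; rewrite ler_pdivrMr//; lra.
Qed.

Lemma cvg_expRN (e : R) : 0 < e -> expR (- (k.+1%:R * e)) @[k --> \oo] --> 0.
Proof.
move=> e0.
have H : `|expR (- e)| < 1 by rewrite ger0_norm ?expR_ge0// expR_lt1 oppr_lt0.
have -> : (fun k => expR (- (k.+1%:R * e))) = (fun k => expR (- e) ^+ k.+1).
  by apply/funext => k; rewrite -expRM_natl mulrN.
by rewrite (cvg_shiftS (GRing.exp (expR (- e)))); exact: cvg_expr.
Qed.

(** A negative rate would already give an empty message set at length 1, which [code] excludes. *)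
Lemma achievable_ge0 (P1 P2 Q0 N : R) r : achievable P1 P2 Q0 N r ->
  0 <= r.1 /\ 0 <= r.2.
Proof.
move=> [C _]; have := M1_gt0 (C 0%N); have := M2_gt0 (C 0%N).
have H (x : R) : (0 < num_msg x 1)%N -> 0 <= x.
  rewrite /num_msg truncn_gt0 powR2E mul1r -[leLHS]expR0 ler_expR pmulr_lge0//.
  by rewrite ln_gt0// ltr1n.
by move=> /H ? /H.
Qed.

Lemma achievable_sum_le (P1 P2 Q0 N : R) r :
  0 < P1 -> 0 < P2 -> 0 < N -> achievable P1 P2 Q0 N r ->
  r.1 + r.2 <= 2^-1 * log2 (1 + (Num.sqrt P1 + Num.sqrt P2) ^+ 2 / N).
Proof.
move=> P10 P20 N0 ach; have [r1 r2] := achievable_ge0 ach.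
case: ach => C [pow err0].
pose P := (Num.sqrt P1 + Num.sqrt P2) ^+ 2.
have P0 : 0 < P by rewrite exprn_gt0// addr_gt0// sqrtr_gt0.
pose V := P + N; have V0 : 0 < V by rewrite addr_gt0.
have ln2 : 0 < ln 2 :> R by rewrite ln_gt0// ltr1n.
have VN0 : 0 < V / N by rewrite divr_gt0.
have VNE : 1 + P / N = V / N by rewrite /V; field; rewrite gt_eqF.
rewrite leNgt; apply/negP; rewrite -/P VNE /log2 mulrA ltr_pdivrMr// => rC.
(* Half of the supposed excess over capacity, in nats. With d = V d1 the change of measure costs exp
   (n d1), which leaves exp (- n d1) after division by the number of messages. *)
pose d1 := ((r.1 + r.2) * ln 2 - 2^-1 * ln (V / N)) / 2.
have d10 : 0 < d1 by rewrite /d1 divr_gt0// subr_gt0.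
have d0 : 0 < V * d1 by rewrite mulr_gt0.
have [e e0 H] := @converse_bound R P1 P2 Q0 N (V * d1) P10 P20 N0 d0.
pose a := P / (P + V * d1).
have a1 : a < 1 by rewrite /a ltr_pdivrMr ?mul1r ?addr_gt0// ltrDl.
(* The 4 accounts for rounding the two message counts, a factor 2 each. *)
pose u (k : nat) : R := a + expR (- (k.+1%:R * e)) + 4 * expR (- (k.+1%:R * d1)).
have ua : u k @[k --> \oo] --> a.
  rewrite -[X in _ --> X]addr0 -[X in _ --> X]addr0; apply: cvgD.
    by apply: cvgD; [exact: cvg_cst|exact: cvg_expRN].
  by rewrite -[X in _ --> X](mulr0 4); apply: cvgM; [exact: cvg_cst|exact: cvg_expRN].
have Hu k : (1 <= error_prob (C k) Q0 N + (u k)%:E)%E.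
  apply: le_trans (H k.+1 _ _ (C k) (ltn0Sn k) (pow k)) _.
  rewrite leeD2l// lee_fin -/P -/V /u -/a lerD2l.
  rewrite (_ : V * d1 / V = d1); last by field; rewrite gt_eqF.
  have -> : Num.sqrt (V / N) = expR (2^-1 * ln (V / N)).
    by rewrite -[in LHS](lnK VN0) -[X in expR X](@mulfVK _ 2)// expRM_natr sqrtr_sqr
      ger0_norm ?expR_ge0// mulrC.
  rewrite -expRM_natl -expRD natrM.
  have M1 := num_msg_ge k.+1 r1; have M2 := num_msg_ge k.+1 r2.
  rewrite ler_pdivrMr; last first.
    by rewrite mulr_gt0// ltr0n num_msg_gt0.
  apply: (@le_trans _ _ (4 * expR (- (k.+1%:R * d1)) *
    (expR (k.+1%:R * (r.1 * ln 2)) / 2 * (expR (k.+1%:R * (r.2 * ln 2)) / 2)))).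
    rewrite (_ : _ * (_ / 2 * (_ / 2)) = expR (- (k.+1%:R * d1)) *
      expR (k.+1%:R * (r.1 * ln 2)) * expR (k.+1%:R * (r.2 * ln 2))); last by field.
    by rewrite -!expRD ler_expR le_eqVlt; apply/orP; left; apply/eqP; rewrite /d1; field.
  by rewrite ler_wpM2l ?mulr_ge0 ?expR_ge0// ler_pM// divr_ge0 ?expR_ge0.
(* In the limit only the Markov term a = P / (P + d) remains, and it is below 1. *)
have : (1 <= 0 + a%:E :> \bar R)%E.
  have cv : (error_prob (C k) Q0 N + (u k)%:E)%E @[k --> \oo] --> (0 + a%:E)%E.
    by apply: cvgeD => //; apply: cvg_EFin => //; exact: nearW.
  rewrite -(cvg_lim _ cv)//; apply: lime_ge; first by apply/cvg_ex; eexists; exact: cv.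
  exact: nearW.
by rewrite add0e lee_fin leNgt a1.
Qed.

End converse_limit.

(** * The dirty paper code *)

Section selection.
Context d (S : measurableType d) (W : eqType).
Implicit Types (w : W) (r : seq W) (c : W -> S -> bool).

(** One rule serves to choose a codeword, read a label and decode. As a finite chain of conditionals
    it is measurable, and its default covers failure. *)
Fixpoint first_in w0 r c (s : S) : W :=
  if r is w :: r' then if c w s then w else first_in w0 r' c s else w0.

Lemma first_in_sat w0 r c s : has (c ^~ s) r -> c (first_in w0 r c s) s.
Proof. by elim: r => //= w r IH; case: ifP. Qed.

Lemma first_in_default w0 r c s : ~~ has (c ^~ s) r -> first_in w0 r c s = w0.
Proof. by elim: r => //= w r IH; rewrite negb_or => /andP[/negbTE-> /IH]. Qed.

Lemma measurable_first_in d' (T : measurableType d') w0 r c (F : W -> S -> T) :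
  (forall w, measurable_fun [set: S] (c w)) ->
  (forall w, measurable_fun [set: S] (F w)) ->
  measurable_fun [set: S] (fun s => F (first_in w0 r c s) s).
Proof.
move=> mc mF; elim: r => //= w r IH.
apply: (eq_measurable_fun (fun s => if c w s then F w s else F (first_in w0 r c s) s)).
  by move=> s _; case: ifP.
exact: measurable_fun_ifT.
Qed.

Lemma measurable_first_in_preimage w0 r c w :
  (forall w, measurable_fun [set: S] (c w)) ->
  measurable [set s | first_in w0 r c s = w].
Proof.
move=> mc.
have mb : measurable_fun [set: S] (fun s => first_in w0 r c s == w).
  by apply: (measurable_first_in w0 r (F := fun w' _ => w' == w)).
have -> : [set s | first_in w0 r c s = w] =
    [set: S] `&` (fun s => first_in w0 r c s == w) @^-1` [set true].
  by apply/seteqP; split=> s /=; [move=> ->; rewrite eqxx|move=> [_ /eqP]].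
exact: mb.
Qed.

End selection.

Lemma first_in_comp d d' (S : measurableType d) (S' : measurableType d') (W : eqType)
    (g : S' -> S) (w0 : W) r c s :
  first_in w0 r c (g s) = first_in w0 r (fun w s' => c w (g s')) s.
Proof. by elim: r => //= w r ->. Qed.

Section dirty_paper_code.
Context (R : realType).
Variables (P1 P2 a D : R) (m M1 M2 L : nat).
Hypotheses (P1_gt0 : 0 < P1) (P2_gt0 : 0 < P2).
Hypotheses (M1_gt0 : (0 < M1)%N) (M2_gt0 : (0 < M2)%N).
Local Notation msg := ('I_M1 * 'I_M2)%type.
Variable u : msg -> 'I_L -> 'I_m -> R.
Implicit Types s : m.+1.-tuple R.

Let P := (Num.sqrt P1 + Num.sqrt P2) ^+ 2.

(** Symbol 0 is spent on exchanging the messages, so the dirty paper code works on the last m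
    symbols only. *)
Definition block (s : m.+1.-tuple R) (i : 'I_m) : R := tnth s (lift ord0 i).

(** Taken on options so that [None] can be the default of [first_in] and signal that the bin has no
    fitting codeword. *)
Definition fits w (o : option 'I_L) s : bool :=
  if o is Some l then
    \sum_i (u w l i - a * block s i) ^+ 2 <= m%:R * P else false.

Definition chosen w s : option 'I_L :=
  first_in None [seq Some l | l <- enum 'I_L] (fits w) s.

(* The power constraint holds surely because nothing is sent when no codeword of
   the bin fits. *)
Definition dpc_input w s (i : 'I_m) : R :=
  if chosen w s is Some l then u w l i - a * block s i else 0.

(** Distinct messages get distinct reals in [0, sqrt Pw), so one noiseless symbol within the power
    budget carries the whole message. *)
Definition label (Pw : R) M (w : 'I_M) : R := Num.sqrt Pw * (w%:R / M%:R).

Definition unlabel (Pw : R) M (M_gt0 : (0 < M)%N) (x : R) : 'I_M :=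
  first_in (Ordinal M_gt0) (enum 'I_M) (fun v x => x == label Pw v) x.

(** The shares of [P1] and [P2] add up to 1, and the squared share times P is the encoder's own
    power. *)
Definition share (Pw : R) : R := Num.sqrt Pw / (Num.sqrt P1 + Num.sqrt P2).

Definition dpc_input_nat w s k : R := oapp (dpc_input w s) 0 (insub k).

(* At time 0 an encoder sends a symbol that reveals its message; at time k.+1 it
   sends its share of symbol k of the dirty paper code. *)
Definition dpc_enc1 (j : nat) (w1 : 'I_M1) s (x : j.-tuple R) : R :=
  if j is k.+1 then
    share P1 * dpc_input_nat (w1, unlabel P2 M2_gt0 (nth 0 x 0)) s k
  else label P1 w1.

Definition dpc_enc2 (j : nat) (w2 : 'I_M2) s (x : j.-tuple R) : R :=
  if j is k.+1 then
    share P2 * dpc_input_nat (unlabel P1 M1_gt0 (nth 0 x 0), w2) s k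
  else label P2 w2.

Definition near_codeword w (y : m.+1.-tuple R) : bool :=
  [exists l, \sum_i (u w l i - a * block y i) ^+ 2 <= m%:R * D].

Definition dpc_dec (y : m.+1.-tuple R) : msg :=
  first_in (Ordinal M1_gt0, Ordinal M2_gt0) (enum {: msg}) near_codeword y.

Lemma measurable_block i : measurable_fun [set: m.+1.-tuple R] (block ^~ i).
Proof. exact: measurable_tnth. Qed.

Lemma measurable_sqdist (x : 'I_m -> R) :
  measurable_fun [set: m.+1.-tuple R] (fun s => \sum_i (x i - a * block s i) ^+ 2).
Proof.
apply: measurable_sum => i; apply: measurable_funX; apply: measurable_funB => //.
by apply: measurable_funM => //; exact: measurable_block.
Qed.

Lemma measurable_dpc_input w i :
  measurable_fun [set: m.+1.-tuple R] (fun s => dpc_input w s i).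
Proof.
apply: (measurable_first_in _ _ (F := fun o s =>
   if o is Some l then u w l i - a * block s i else 0)) => -[l|].
- by apply: measurable_fun_ler => //; exact: measurable_sqdist.
- exact: measurable_cst.
- apply: measurable_funB => //.
  by apply: measurable_funM => //; exact: measurable_block.
- exact: measurable_cst.
Qed.

Lemma measurable_dpc_input_nat w k :
  measurable_fun [set: m.+1.-tuple R] (fun s => dpc_input_nat w s k).
Proof.
rewrite /dpc_input_nat; case: insub => [i|] /=; last exact: measurable_cst.
exact: measurable_dpc_input.
Qed.

Lemma measurable_nth0 j (k : nat) :
  measurable_fun [set: j.-tuple R] (fun x => nth 0 x k).
Proof.
have [kj|jk] := ltnP k j.
  apply: (eq_measurable_fun (fun x => tnth x (Ordinal kj))).
    by move=> x _; rewrite (tnth_nth 0).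
  exact: measurable_tnth.
rewrite (_ : (fun x : j.-tuple R => nth 0 x k) = cst 0) //.
by apply/funext => x; rewrite nth_default ?size_tuple.
Qed.

Lemma measurable_unlabel d (T : measurableType d) d' (T' : measurableType d')
    (Pw : R) M (M_gt0 : (0 < M)%N) (g : T -> R) (F : 'I_M -> T -> T') :
  measurable_fun [set: T] g -> (forall v, measurable_fun [set: T] (F v)) ->
  measurable_fun [set: T] (fun t => F (unlabel Pw M_gt0 (g t)) t).
Proof.
move=> mg mF; rewrite /unlabel.
under eq_fun do rewrite (first_in_comp g).
apply: measurable_first_in => // v.
exact: measurable_fun_eqr.
Qed.

Lemma measurable_dpc_enc1 j w1 : (j < m.+1)%N ->
  measurable_fun [set: m.+1.-tuple R * j.-tuple R]
    (fun p => dpc_enc1 w1 p.1 p.2).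
Proof.
case: j => [|k] _; first exact: measurable_cst.
apply: measurable_funM => //.
apply: (@measurable_unlabel _ (m.+1.-tuple R * k.+1.-tuple R)%type _ _
  P2 M2 M2_gt0 (fun p => nth 0 p.2 0) (fun v p => dpc_input_nat (w1, v) p.1 k)).
  exact: measurableT_comp (@measurable_nth0 _ _) measurable_snd.
move=> v; exact: measurableT_comp (@measurable_dpc_input_nat _ _) measurable_fst.
Qed.

Lemma measurable_dpc_enc2 j w2 : (j < m.+1)%N ->
  measurable_fun [set: m.+1.-tuple R * j.-tuple R]
    (fun p => dpc_enc2 w2 p.1 p.2).
Proof.
case: j => [|k] _; first exact: measurable_cst.
apply: measurable_funM => //.
apply: (@measurable_unlabel _ (m.+1.-tuple R * k.+1.-tuple R)%type _ _
  P1 M1 M1_gt0 (fun p => nth 0 p.2 0) (fun v p => dpc_input_nat (v, w2) p.1 k)).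
  exact: measurableT_comp (@measurable_nth0 _ _) measurable_snd.
move=> v; exact: measurableT_comp (@measurable_dpc_input_nat _ _) measurable_fst.
Qed.

Lemma measurable_near_codeword w :
  measurable_fun [set: m.+1.-tuple R] (near_codeword w).
Proof.
rewrite /near_codeword.
apply: (eq_measurable_fun (fun y => has (fun l =>
   \sum_i (u w l i - a * block y i) ^+ 2 <= m%:R * D) (enum 'I_L))).
  move=> y _; apply/hasP/existsP => -[l]; last by exists l; rewrite // mem_enum.
  by move=> _ ?; exists l.
elim: (enum 'I_L) => [|l r IH]/=; first exact: measurable_cst.
apply: measurable_or => //.
by apply: measurable_fun_ler => //; exact: measurable_sqdist.
Qed.

Lemma measurable_dpc_dec w : measurable (dpc_dec @^-1` [set w]).
Proof. exact: measurable_first_in_preimage measurable_near_codeword. Qed.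

Definition dpc_code : Defs.code R m.+1 M1 M2 :=
  Code M1_gt0 M2_gt0 measurable_dpc_enc1 measurable_dpc_enc2 measurable_dpc_dec.

Lemma label_inj (Pw : R) M : 0 < Pw -> (0 < M)%N -> injective (@label Pw M).
Proof.
move=> Pw0 M0 w w'; rewrite /label.
have s0 : Num.sqrt Pw != 0 by rewrite gt_eqF ?sqrtr_gt0.
have M0' : M%:R^-1 != 0 :> R by rewrite invr_eq0 pnatr_eq0 -lt0n.
by move=> /(mulfI s0)/(mulIf M0')/eqP; rewrite eqr_nat => /eqP/val_inj.
Qed.

Lemma labelK (Pw : R) M (M_gt0 : (0 < M)%N) : 0 < Pw ->
  cancel (@label Pw M) (unlabel Pw M_gt0).
Proof.
move=> Pw0 w; apply: (label_inj Pw0 M_gt0); apply/esym/eqP.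
apply: (@first_in_sat _ _ _ _ _ (fun v x => x == label Pw v)).
by apply/hasP; exists w; rewrite ?mem_enum.
Qed.

Lemma label_sqr_le (Pw : R) M (w : 'I_M) : 0 < Pw -> label Pw w ^+ 2 <= Pw.
Proof.
move=> Pw0; rewrite /label exprMn sqr_sqrtr ?(ltW Pw0)//.
have M0 : (0 < M)%N by apply: leq_ltn_trans (ltn_ord w).
apply: ler_piMr; first exact: ltW.
apply: exprn_ile1; first by rewrite divr_ge0.
by rewrite ler_pdivrMr ?ltr0n// mul1r ler_nat ltnW.
Qed.

(** From time 1 on, symbol 0 of the other encoder is in the observed past and [unlabel] inverts it.
    Both encoders thus compute the same [dpc_input] and send their shares of it. *)
Lemma dpc_inputsE w1 w2 s k j : (j < k)%N ->
  nth 0 (inputs dpc_code w1 w2 s k).1 j =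
    (if j is i.+1 then share P1 * dpc_input_nat (w1, w2) s i else label P1 w1) /\
  nth 0 (inputs dpc_code w1 w2 s k).2 j =
    (if j is i.+1 then share P2 * dpc_input_nat (w1, w2) s i else label P2 w2).
Proof.
elim: k j => // k IH j; rewrite ltnS leq_eqVlt => /predU1P[->|jk] /=; last first.
  have := IH _ jk; case: inputs => x1 x2 /= [h1 h2].
  by rewrite !nth_rcons !size_tuple jk.
case: inputs IH => x1 x2 /= IH.
rewrite !nth_rcons !size_tuple ltnn eqxx /dpc_enc1 /dpc_enc2.
case: k x1 x2 IH => // k x1 x2 /(_ 0%N isT) [-> ->].
by rewrite !labelK.
Qed.

Lemma dpc_input1E w1 w2 s (i : 'I_m.+1) : tnth (input1 dpc_code w1 w2 s) i =
  if unlift ord0 i is Some k then share P1 * dpc_input (w1, w2) s k else label P1 w1.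
Proof.
rewrite (tnth_nth 0) (dpc_inputsE w1 w2 s (ltn_ord i)).1.
case: unliftP => [k ->|->]//=.
by rewrite /dpc_input_nat valK.
Qed.

Lemma dpc_input2E w1 w2 s (i : 'I_m.+1) : tnth (input2 dpc_code w1 w2 s) i =
  if unlift ord0 i is Some k then share P2 * dpc_input (w1, w2) s k else label P2 w2.
Proof.
rewrite (tnth_nth 0) (dpc_inputsE w1 w2 s (ltn_ord i)).2.
case: unliftP => [k ->|->]//=.
by rewrite /dpc_input_nat valK.
Qed.

Lemma dpc_output_block w1 w2 s z i :
  block (output dpc_code w1 w2 s z) i =
  dpc_input (w1, w2) s i + block s i + block z i.
Proof.
rewrite /block /output tnth_mktuple dpc_input1E dpc_input2E liftK.
congr (_ + _ + _); rewrite -mulrDl -[RHS]mul1r; congr (_ * _).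
by rewrite /share -mulrDl divff// gt_eqF// addr_gt0 ?sqrtr_gt0.
Qed.

Lemma chosen_fits w s l : chosen w s = Some l ->
  \sum_i (u w l i - a * block s i) ^+ 2 <= m%:R * P.
Proof.
rewrite /chosen => E; set r := [seq Some l | l <- enum 'I_L] in E.
have [h|h] := boolP (has (fits w ^~ s) r).
  by have := first_in_sat None h; rewrite E.
by rewrite first_in_default in E.
Qed.

Lemma dpc_input_energy w s : \sum_i dpc_input w s i ^+ 2 <= m%:R * P.
Proof.
rewrite /dpc_input; case E: chosen => [l|]; first exact: chosen_fits E.
by rewrite big1 ?mulr_ge0 ?sqr_ge0// => i _; rewrite expr0n.
Qed.

(** For every message pair and state, symbol 0 costs at most Pw and the other m symbols at most
    (share)^2 m P = m Pw, hence (m + 1) Pw in total. *)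
Lemma dpc_power Q0 : power_constraint dpc_code Q0 P1 P2.
Proof.
have bound Pw (x : msg -> m.+1.-tuple R -> m.+1.-tuple R) (b : msg -> R) : 0 < Pw ->
    (forall w, b w ^+ 2 <= Pw) ->
    (forall w s i, tnth (x w s) i =
       if unlift ord0 i is Some k then share Pw * dpc_input w s k else b w) ->
    (forall w1 w2 i, measurable_fun [set: m.+1.-tuple R]
       (fun s => tnth (x (w1, w2) s) i)) ->
    (mean_power Q0 (fun w1 w2 => x (w1, w2)) <= Pw%:E)%E.
  move=> Pw0 bP xE mx; rewrite mean_powerE//.
  have E w s : \sum_i tnth (x w s) i ^+ 2 <= m.+1%:R * Pw.
    rewrite big_ord_recl xE unlift_none -natr1 addrC mulrDl mul1r; apply: lerD => //.
    under eq_bigr do rewrite xE liftK exprMn.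
    rewrite -mulr_sumr; apply: (@le_trans _ _ (share Pw ^+ 2 * (m%:R * P))).
      by rewrite ler_wpM2l ?sqr_ge0 ?dpc_input_energy.
    rewrite /share /P exprMn sqr_sqrtr ?(ltW Pw0)// exprVn le_eqVlt; apply/orP; left.
    by apply/eqP; field; rewrite gt_eqF// addr_gt0// sqrtr_gt0.
  have I w : (\int[state_law m.+1 Q0]_s (\sum_i tnth (x (w.1, w.2) s) i ^+ 2)%:E <=
      (m.+1%:R * Pw)%:E)%E.
    apply: (@le_trans _ _ (\int[state_law m.+1 Q0]_s (m.+1%:R * Pw)%:E)%E).
      apply: ge0_le_integral => //.
      - by move=> s _; rewrite lee_fin sumr_ge0// => i _; exact: sqr_ge0.
      - apply/measurable_EFinP; apply: measurable_sum => i.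
        by apply: measurable_funX; exact: mx.
      - by move=> s _; rewrite lee_fin; exact: E.
    by rewrite integral_cst//= [X in (_ * X)%E]probability_setT mule1.
  have mP0 : (0 <= (m.+1%:R * Pw)%:E)%E by rewrite lee_fin mulr_ge0// ltW.
  apply: (@le_trans _ _ (m.+1%:R^-1%:E * (m.+1%:R * Pw)%:E)%E).
    apply: lee_wpmul2l; first by rewrite lee_fin invr_ge0.
    rewrite -[leRHS](sum_msg_cst dpc_code mP0).
    by apply: lee_wpmul2l; rewrite ?lee_fin ?invr_ge0//; apply: lee_sum => w _; exact: I.
  by rewrite -EFinM mulKf// pnatr_eq0.
split.
- apply: (bound P1 (fun w => input1 dpc_code w.1 w.2) (fun w => label P1 w.1)) => //.
  + by move=> w; exact: label_sqr_le.
  + by move=> [w1 w2] s i; exact: dpc_input1E.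
  + by move=> w1 w2 i; exact: measurable_input1.
- apply: (bound P2 (fun w => input2 dpc_code w.1 w.2) (fun w => label P2 w.2)) => //.
  + by move=> w; exact: label_sqr_le.
  + by move=> [w1 w2] s i; exact: dpc_input2E.
  + by move=> w1 w2 i; exact: measurable_input2.
Qed.

(** If X = U - a S is sent, then U - a Y = (1 - a) X - a Z. So once a codeword fits and this
    effective noise is small, the true bin passes the decoder's test; an error then means that the
    decoded bin, a different one, passes it too. *)
Lemma dpc_error w s z :
  dec dpc_code (output dpc_code w.1 w.2 s z) <> w ->
  [\/ [forall l, ~~ fits w (Some l) s],
      m%:R * D <= \sum_i ((1 - a) * dpc_input w s i - a * block z i) ^+ 2 |
      exists w' l, w' != w /\
        \sum_i (u w' l i - a * (dpc_input w s i + block s i + block z i)) ^+ 2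
          <= m%:R * D].
Proof.
case: w => w1 w2 /= err.
have [nofit|fit] := boolP [forall l, ~~ fits (w1, w2) (Some l) s]; first exact: Or31.
have [noisy|quiet] := leP (m%:R * D)
  (\sum_i ((1 - a) * dpc_input (w1, w2) s i - a * block z i) ^+ 2).
  exact: Or32.
apply: Or33; set y := output _ _ _ _ _ in err.
have yE := dpc_output_block w1 w2 s z.
have right : near_codeword (w1, w2) y.
  move: fit; rewrite negb_forall => /existsP[l0]; rewrite negbK => fit0.
  have : chosen (w1, w2) s <> None.
    move=> E; have h : has (fits (w1, w2) ^~ s) [seq Some l | l <- enum 'I_L].
      by apply/hasP; exists (Some l0) => //; apply/mapP; exists l0; rewrite ?mem_enum.
    by have := first_in_sat None h; rewrite -/(chosen _ _) E.
  case E: (chosen (w1, w2) s) => [l|//] _; apply/existsP; exists l.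
  apply: le_trans (ltW quiet); rewrite le_eqVlt; apply/orP; left; apply/eqP.
  apply: eq_bigr => i _; rewrite yE /dpc_input E; congr (_ ^+ 2); ring.
have : near_codeword (dpc_dec y) y.
  apply: first_in_sat; apply/hasP; exists (w1, w2) => //.
  by rewrite mem_enum.
case/existsP=> l lP; exists (dpc_dec y), l; split; first exact/eqP.
by under eq_bigr do rewrite -yE.
Qed.

End dirty_paper_code.

(** Integrates a pointwise count over codebooks. [H] is an exceptional set common to all of them, r
    the fraction of codebooks that may fail at any given point, and [F i] an exceptional set of
    codebook i. *)
Lemma sum_measure_le d (T : measurableType d) (R : realType) (mu : probability T R)
    (I : finType) (E F : I -> set T) (H : set T) (r pH pF : R) :
  (forall i, measurable (E i)) -> (forall i, measurable (F i)) -> measurable H ->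
  0 <= r ->
  (forall t, \sum_i \1_(E i) t <= #|I|%:R * \1_H t + #|I|%:R * r + \sum_i \1_(F i) t) ->
  (mu H <= pH%:E)%E -> (forall i, mu (F i) <= pF%:E)%E ->
  (\sum_i mu (E i) <= #|I|%:R%:E * (pH + r + pF)%:E)%E.
Proof.
move=> mE mF mH r0 count HpH FpF; set K := #|I|%:R.
have K0 : (0 : R) <= K by rewrite /K.
have mI X : measurable X -> measurable_fun [set: T] (fun t => (\1_X t)%:E : \bar R).
  by move=> mX; apply/measurable_EFinP; exact: measurable_indic.
have IE X : measurable X -> (mu X = \int[mu]_t (\1_X t)%:E)%E.
  by move=> mX; rewrite [RHS]integral_indic// setIT.
have -> : (\sum_(i : I) mu (E i) =
    \int[mu]_t \sum_(i : I) (\1_(E i) t)%:E)%E.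
  rewrite ge0_integral_sum//; first by apply: eq_bigr => i _; exact: IE.
  by move=> i; exact: mI.
apply: (@le_trans _ _ (\int[mu]_t (K%:E * (\1_H t)%:E + (K * r)%:E +
    \sum_(i : I) (\1_(F i) t)%:E))%E).
  apply: ge0_le_integral => //.
  - by move=> t _; apply: sume_ge0 => i _; rewrite lee_fin.
  - by apply: emeasurable_sum => i; exact: mI.
  - apply: emeasurable_funD; last by apply: emeasurable_sum => i; exact: mI.
    by apply: emeasurable_funD => //; apply: emeasurable_funM => //; exact: mI.
  move=> t _; rewrite -EFinM -EFinD !sumEFin -EFinD lee_fin.
  exact: count.
rewrite ge0_integralD//; last 4 first.
- by move=> t _; rewrite adde_ge0// ?mule_ge0 ?lee_fin// mulr_ge0.
- by apply: emeasurable_funD => //; apply: emeasurable_funM => //; exact: mI.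
- by move=> t _; apply: sume_ge0 => i _; rewrite lee_fin.
- by apply: emeasurable_sum => i; exact: mI.
rewrite ge0_integralD//; last 3 first.
- by move=> t _; rewrite mule_ge0 ?lee_fin.
- by apply: emeasurable_funM => //; exact: mI.
- by move=> t _; rewrite lee_fin mulr_ge0.
rewrite ge0_integralZl//; last first.
  exact: mI.
rewrite -IE// integral_cst// [X in ((_ + _ * X) + _)%E]probability_setT mule1.
rewrite ge0_integral_sum//; last first.
  by move=> i; exact: mI.
have -> : (K%:E * (pH + r + pF)%:E = K%:E * pH%:E + (K * r)%:E + (K * pF)%:E)%E.
  by rewrite -!EFinM -!EFinD !mulrDr.
apply: leeD.
  by rewrite leeD2r//; apply: lee_wpmul2l; rewrite ?lee_fin//; exact: HpH.
apply: (@le_trans _ _ (\sum_(i : I) pF%:E)%E).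
  by apply: lee_sum => i _; rewrite -IE//; exact: FpF.
by rewrite sumEFin lee_fin sumr_const mulr_natl.
Qed.

Lemma error_prob_ge0 (R : realType) n M1 M2 (C : Defs.code R n M1 M2) Q0 N :
  (0 <= error_prob C Q0 N)%E.
Proof.
rewrite /error_prob msg_meanE mule_ge0 ?lee_fin ?invr_ge0//.
by apply: sume_ge0 => w _.
Qed.

(** * Achievability *)

Section random_coding.
Context (R : realType).
Variables (P1 P2 Q0 N a A pS pN : R) (m M1 M2 x y : nat).
Hypotheses (P1_gt0 : 0 < P1) (P2_gt0 : 0 < P2) (A_ge0 : 0 <= A) (m_gt0 : (0 < m)%N).
Hypotheses (M1_gt0 : (0 < M1)%N) (M2_gt0 : (0 < M2)%N).
Local Notation msg := ('I_M1 * 'I_M2)%type.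
Local Notation n := m.+1.
Local Notation sigma := (state_law n Q0).
Local Notation nu := (noise_law n N).
Let P := (Num.sqrt P1 + Num.sqrt P2) ^+ 2.
Let D := (x.+1%:R / y.+1%:R) ^+ 2 * P.

Hypothesis state_tail :
  (sigma [set s | (A ^+ 2 < \sum_i (a * block s i) ^+ 2)%R] <= pS%:E)%E.
Hypothesis noise_tail : forall X : 'I_m -> R, \sum_i X i ^+ 2 <= m%:R * P ->
  (nu [set z | (m%:R * D <= \sum_i ((1 - a) * X i - a * block z i) ^+ 2)%R] <= pN%:E)%E.

Let P_gt0 : 0 < P. Proof. by rewrite exprn_gt0// addr_gt0 ?sqrtr_gt0. Qed.

Section codebooks.
Variables (G : finType) (pos : G -> 'I_m -> R) (B L : nat).
Hypothesis B_gt0 : (0 < B)%N.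
Hypothesis cover : forall c : 'I_m -> R, \sum_i c i ^+ 2 <= A ^+ 2 ->
  (y.+1 ^ m * B <= #|[set g : G | (\sum_i (pos g i - c i) ^+ 2 <= m%:R * P)%R]%SET|)%N.
Hypothesis pack : forall c : 'I_m -> R,
  (#|[set g : G | (\sum_i (pos g i - c i) ^+ 2 <= m%:R * D)%R]%SET| <=
     2 * x.+1 ^ m * B)%N.
(** Guaranteed fraction of grid points that fit a given state. With q L >= m a bin fails to cover
    with probability at most e^(-m); with q L <= m + 1 the codebook is only a linear factor larger
    than covering demands. *)
Let q : R := (y.+1 ^ m * B)%:R / #|G|%:R.
Hypothesis L_ge : m%:R <= q * L%:R.
Hypothesis L_le : q * L%:R <= m%:R + 1.

Local Notation codebook := {ffun msg * 'I_L -> G}.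
Let u (cb : codebook) (w : msg) (l : 'I_L) : 'I_m -> R := pos (cb (w, l)).
Let code_of (cb : codebook) := dpc_code P1 P2 a D M1_gt0 M2_gt0 (u cb).
Let err (cb : codebook) (w : msg) :=
  [set sz | dec (code_of cb) (output (code_of cb) w.1 w.2 sz.1 sz.2) <> w].
Let noisy (cb : codebook) (w : msg) := [set sz : n.-tuple R * n.-tuple R |
  (m%:R * D <= \sum_i ((1 - a) * dpc_input P1 P2 a (u cb) w sz.1 i -
                         a * block sz.2 i) ^+ 2)%R].
Let far := [set sz : n.-tuple R * n.-tuple R |
  (A ^+ 2 < \sum_i (a * block sz.1 i) ^+ 2)%R].
(** Covering failure plus a union bound over M1 M2 L codewords, each near the output with
    probability at most 2 (x + 1)^m B / |G|. By definition of [q] this product is 2 M1 M2 (q L)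
    times the m-th power of the radius ratio. *)
Let r : R := expR (- m%:R) +
  2 * (M1 * M2)%:R * (m%:R + 1) * (x.+1%:R / y.+1%:R) ^+ m.

Lemma card_grid_gt0 : (0 < #|G|)%N.
Proof.
have /leq_trans : (0 < y.+1 ^ m * B)%N by rewrite muln_gt0 expn_gt0.
apply; apply: leq_trans (cover (c := fun=> 0) _) (max_card _).
by rewrite big1 ?sqr_ge0// => i _; rewrite expr0n.
Qed.

(** State and noise are fixed, so only the codebook varies, and the three alternatives of
    [dpc_error] are counted separately. When the state is far the covering bound is given up and all
    codebooks are charged to [far]. *)
Lemma codebook_count w (s z : n.-tuple R) :
  \sum_(cb : codebook) (\1_(err cb w) (s, z) : R) <=
  #|{: codebook}|%:R * \1_far (s, z) + #|{: codebook}|%:R * r +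
  \sum_(cb : codebook) \1_(noisy cb w) (s, z).
Proof.
have G0 : (0 : R) < #|G|%:R by rewrite ltr0n card_grid_gt0.
have q0 : 0 < q by rewrite divr_gt0// ltr0n muln_gt0 expn_gt0.
pose miss (cb : codebook) := [forall l, ~~ fits P1 P2 a (u cb) w (Some l) s].
pose T (cb : codebook) := [set g : G |
  \sum_i (pos g i - a * (dpc_input P1 P2 a (u cb) w s i + block s i + block z i)) ^+ 2
     <= m%:R * D]%SET.
pose hit (cb : codebook) := \sum_(w' : msg) \sum_(l : 'I_L)
   ((w' != w) && (cb (w', l) \in T cb) : nat).
have step cb : (\1_(err cb w) (s, z) : R) <=
    (miss cb)%:R + (hit cb)%:R + \1_(noisy cb w) (s, z).
  rewrite indicE; have [|] := boolP ((s, z) \in err cb w); last first.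
    by rewrite !addr_ge0// indicE.
  rewrite inE /err/= => /(dpc_error P1_gt0 P2_gt0)[miss1|noisy1|].
  - by rewrite /miss miss1 -addrA lerDl addr_ge0// indicE.
  - rewrite indicE mem_set// lerDr addr_ge0//.
  - move=> [w' [l [ww' near']]].
    have : (1 <= hit cb)%N.
      rewrite /hit (bigD1 w')//= (bigD1 l)//= ww'/= finset.inE.
      by rewrite near'.
    rewrite -(ler1n R) /= => hit1.
    have n0 : 0 <= \1_(noisy cb w) (s, z) :> R by rewrite indicE.
    apply: (le_trans hit1); rewrite addrAC lerDr addr_ge0//.
apply: le_trans (ler_sum _ (fun cb _ => step cb)) _.
rewrite 2!big_split/= lerD2r; apply: (@le_trans _ _ (#|{: codebook}|%:R * \1_far (s, z) +
   #|{: codebook}|%:R * expR (- m%:R) +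
   #|{: codebook}|%:R * (2 * (M1 * M2)%:R * (m%:R + 1) * (x.+1%:R / y.+1%:R) ^+ m))); last first.
  by rewrite -addrA -mulrDr.
apply: lerD.
  have -> : \sum_cb ((miss cb)%:R : R) = #|[set cb | miss cb]%SET|%:R.
    by rewrite -natr_sum -big_mkcond/= -sum1dep_card.
  rewrite indicE; have [_|] := boolP ((s, z) \in far).
    by rewrite mulr1 -[leLHS]addr0; apply: lerD; rewrite ?mulr_ge0 ?expR_ge0// ler_nat max_card.
  rewrite mulr0 add0r notin_setE /far/= => /negP; rewrite -leNgt => near0.
  pose S := [set g : G | \sum_i (pos g i - a * block s i) ^+ 2 <= m%:R * P]%SET.
  have qS : q * #|G|%:R <= #|S|%:R.
    by rewrite /q divfK ?gt_eqF// ler_nat; exact: cover near0.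
  rewrite [leRHS]mulrC.
  apply: (@le_trans _ _ (expR (- (q * L%:R)) * #|{: codebook}|%:R)); last first.
    by rewrite ler_wpM2r// ler_expR lerN2.
  apply: le_trans (@card_codebook_miss _ _ L R w S q qS); rewrite ler_nat subset_leq_card//.
  apply/fintype.subsetP => cb; rewrite !finset.inE => /forallP H; apply/forallP => l.
  by have := H l; rewrite finset.inE.
have -> : \sum_cb ((hit cb)%:R : R) = (\sum_cb hit cb)%:R by rewrite natr_sum.
pose t := (2 * x.+1 ^ m * B)%N.
have hit_le : (#|G| * \sum_cb hit cb <= (M1 * M2 * L) * (t * #|{: codebook}|))%N.
  rewrite /hit exchange_big/= big_distrr/=.
  apply: (@leq_trans (\sum_(w' : msg) \sum_(l : 'I_L) t * #|{: codebook}|)%N).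
    apply: leq_sum => w' _; rewrite exchange_big/= big_distrr/=; apply: leq_sum => l _.
    have [->|ww'] := eqVneq w' w; first by rewrite /= big1// muln0.
    have -> : (\sum_(cb : codebook) (true && (cb (w', l) \in T cb)) =
        #|[set cb : codebook | cb (w', l) \in T cb]%SET|)%N.
      by rewrite -sum1dep_card [RHS]big_mkcond; apply: eq_bigr => cb _; case: (_ \in _).
    apply: card_codebook_hit => [cb cb' E|cb]; last exact: pack.
    (* The output depends on the codebook through bin w alone, so the entry of another bin w' is
       independent of the set it has to hit. *)
    have uE : u cb w = u cb' w.
      apply/funext => k; rewrite /u E//.
      by apply/negP => /eqP[ww]; rewrite ww eqxx in ww'.
    have dE i : dpc_input P1 P2 a (u cb) w s i = dpc_input P1 P2 a (u cb') w s i.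
      by rewrite /dpc_input /chosen /fits uE.
    by apply/setP => g; rewrite !finset.inE; under eq_bigr do rewrite dE.
  by rewrite sum_nat_const sum_nat_const card_prod !card_ord mulnA.
have hitR : (\sum_cb hit cb)%:R * #|G|%:R <=
    (M1 * M2)%:R * L%:R * (2 * x.+1%:R ^+ m * B%:R) * #|{: codebook}|%:R :> R.
  by rewrite -natrX -!natrM ler_nat mulnC -mulnA.
rewrite -(ler_pM2r G0); apply: le_trans hitR _.
have y0 : y.+1%:R ^+ m != 0 :> R by rewrite expf_neq0// pnatr_eq0.
(* Eliminates the unknown count [B]: the sizes of [G] cancel and only q L and the radius ratio
   survive. *)
have BE : B%:R = q * #|G|%:R / y.+1%:R ^+ m.
  by rewrite /q divfK ?gt_eqF// natrM natrX mulrC mulKf.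
rewrite BE (_ : _ * _ = #|{: codebook}|%:R * (2 * (M1 * M2)%:R *
   (q * L%:R) * (x.+1%:R / y.+1%:R) ^+ m) * #|G|%:R).
  rewrite ler_wpM2r// ler_wpM2l// ler_wpM2r ?exprn_ge0 ?divr_ge0//.
  by rewrite ler_wpM2l// mulr_ge0.
by rewrite exprMn exprVn; field; rewrite expf_neq0// pnatr_eq0.
Qed.

Let measurable_err cb w : measurable (err cb w).
Proof. exact: measurable_error. Qed.

Let measurable_noisy cb w : measurable (noisy cb w).
Proof.
pose f (sz : n.-tuple R * n.-tuple R) : R :=
  \sum_i ((1 - a) * dpc_input P1 P2 a (u cb) w sz.1 i - a * block sz.2 i) ^+ 2.
have mf : measurable_fun [set: n.-tuple R * n.-tuple R] f.
  apply: measurable_sum => i; apply: measurable_funX; apply: measurable_funB.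
    apply: measurable_funM => //.
    exact: measurableT_comp (@measurable_dpc_input _ _ _ _ _ _ _ _ _ _ _) measurable_fst.
  apply: measurable_funM => //.
  exact: measurableT_comp (@measurable_block _ _ _) measurable_snd.
exact: measurable_superlevel mf.
Qed.

Let measurable_far1 : measurable
  [set s : n.-tuple R | (A ^+ 2 < \sum_i (a * block s i) ^+ 2)%R].
Proof.
pose f (s : n.-tuple R) : R := \sum_i (a * block s i) ^+ 2.
have mf : measurable_fun [set: n.-tuple R] f.
  apply: measurable_sum => i; apply: measurable_funX; apply: measurable_funM => //.
  exact: measurable_block.
exact: measurable_strict_superlevel mf.
Qed.

Let farE : far = [set s | (A ^+ 2 < \sum_i (a * block s i) ^+ 2)%R] `*` [set: n.-tuple R].
Proof. by apply/seteqP; split=> [sz|sz []]. Qed.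

Let measurable_far : measurable far.
Proof. by rewrite farE; exact: measurableX. Qed.

Lemma far_le : ((sigma \x nu) far <= pS%:E)%E.
Proof.
rewrite farE product_measure1E//; rewrite [X in (_ * X)%E]probability_setT mule1.
exact: state_tail.
Qed.

Lemma noisy_le cb w : ((sigma \x nu) (noisy cb w) <= pN%:E)%E.
Proof.
have -> : ((sigma \x nu) (noisy cb w) =
   \int[sigma]_s nu (xsection (noisy cb w) s))%E by [].
have pN0 : (0 <= pN%:E)%E.
  apply: le_trans (noise_tail (X := fun=> 0) _); first exact: measure_ge0.
  by rewrite big1 ?mulr_ge0 ?(ltW P_gt0)// => i _; rewrite expr0n.
apply: (@le_trans _ _ (\int[sigma]_s pN%:E)%E); last first.
  by rewrite integral_cst//= [X in (_ * X)%E]probability_setT mule1.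
apply: ge0_le_integral => //.
  exact: measurable_fun_xsection.
move=> s _; have -> : xsection (noisy cb w) s = [set z |
    (m%:R * D <= \sum_i ((1 - a) * dpc_input P1 P2 a (u cb) w s i - a * block z i) ^+ 2)%R].
  by rewrite /xsection; apply/seteqP; split=> z; rewrite /= inE.
exact/noise_tail/dpc_input_energy.
Qed.

Lemma sum_codebook_error w : (\sum_(cb : codebook) (sigma \x nu) (err cb w) <=
  #|{: codebook}|%:R%:E * (pS + r + pN)%:E)%E.
Proof.
apply: (@sum_measure_le _ _ _ (sigma \x nu)%E _ (err ^~ w) (noisy ^~ w) far) => //.
- by rewrite addr_ge0 ?expR_ge0// !mulr_ge0 ?addr_ge0// exprn_ge0// divr_ge0.
- by move=> [s z]; exact: codebook_count.
- exact: far_le.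
- by move=> cb; exact: noisy_le.
Qed.

(** The codebook of least error probability does no worse than the average one. *)
Lemma good_codebook : exists cb : codebook,
  (error_prob (code_of cb) Q0 N <= (pS + r + pN)%:E)%E.
Proof.
have G0 := card_grid_gt0.
(* Serves only to extract an element of the nonempty [G]. *)
have [g0 _] := eq_bigmax_cond (fun=> 0%N) G0.
pose cb0 : codebook := [ffun=> g0].
pose F (cb : codebook) := error_prob (code_of cb) Q0 N.
have [cb _ cbmin] := @arg_minP _ (\bar R) _ cb0 predT F isT.
exists cb; set K := #|{: codebook}|%:R : R.
have K0 : 0 < K by rewrite ltr0n; apply/card_gt0P; exists cb0.
rewrite -(@lee_pmul2l _ K%:E)//.
apply: (@le_trans _ _ (\sum_(cb : codebook) F cb)%E).
  rewrite -sume_cst; last exact: error_prob_ge0.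
  by apply: lee_sum => cb' _; exact: cbmin.
rewrite /F /error_prob; under eq_bigr do rewrite msg_meanE.
rewrite -ge0_sume_distrr => [|cb' _]; last exact: sume_ge0.
rewrite exchange_big/=.
apply: (@le_trans _ _ ((M1 * M2)%:R^-1%:E *
  \sum_(w : msg) (K%:E * (pS + r + pN)%:E))%E).
  apply: lee_wpmul2l; first by rewrite lee_fin invr_ge0.
  by apply: lee_sum => -[w1 w2] _; exact: sum_codebook_error.
rewrite (sum_msg_cst (code_of cb0))// mule_ge0 ?lee_fin ?(ltW K0)//.
have pS0 : 0 <= pS by rewrite -lee_fin; apply: le_trans state_tail.
have pN0 : 0 <= pN.
  rewrite -lee_fin; apply: le_trans (noise_tail (X := fun=> 0) _) => //.
  by rewrite big1 ?mulr_ge0 ?(ltW P_gt0)// => i _; rewrite expr0n.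
by rewrite !addr_ge0 ?expR_ge0// !mulr_ge0 ?addr_ge0// exprn_ge0// divr_ge0.
Qed.

End codebooks.

Lemma random_coding_bound : exists C : Defs.code R n M1 M2,
  power_constraint C Q0 P1 P2 /\
  (error_prob C Q0 N <= (pS + (expR (- m%:R) +
     2 * (M1 * M2)%:R * (m%:R + 1) * (x.+1%:R / y.+1%:R) ^+ m) + pN)%:E)%E.
Proof.
have [G [pos [B [B_gt0 cover pack]]]] := grid_counting x y m_gt0 P_gt0 A_ge0.
have G0 := card_grid_gt0 B_gt0 cover.
pose q : R := (y.+1 ^ m * B)%:R / #|G|%:R.
have GR0 : (0 : R) < #|G|%:R by rewrite ltr0n.
have q0 : 0 < q by rewrite divr_gt0// ltr0n muln_gt0 expn_gt0.
have q1 : q <= 1.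
  rewrite ler_pdivrMr// mul1r ler_nat; apply: leq_trans (cover (fun=> 0) _) (max_card _).
  by rewrite big1 ?sqr_ge0// => i _; rewrite expr0n.
(* Rounding m / q up overshoots q L by at most q, and q <= 1. *)
pose L := (Num.truncn (m%:R / q)).+1.
have L1 : m%:R <= q * L%:R.
  by rewrite mulrC -ler_pdivrMr// ltW// truncnS_gt.
have L2 : q * L%:R <= m%:R + 1.
  rewrite -natr1 mulrDr mulr1 lerD// mulrC -ler_pdivlMr//.
  by rewrite truncn_le// divr_ge0// ltW.
have [cb errcb] := @good_codebook G pos B L B_gt0 cover pack L1 L2.
eexists; split; last exact: errcb.
exact: dpc_power.
Qed.

End random_coding.

Section achievability.
Context (R : realType).

(** The effective noise has mean energy at most a^2 N + (1 - a)^2 P per symbol. The law has [m.+1]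
    coordinates but the sum only m of them; the constant C pays for the extra one. *)
Lemma effective_noise_tail (P N a d : R) : 0 < P -> 0 < N -> 0 < a -> 0 < d ->
  exists C e : R, [/\ 0 < C, 0 < e &
    forall m (X : 'I_m -> R), \sum_i X i ^+ 2 <= m%:R * P ->
    (iid (gauss N) m.+1 [set z | (m%:R * (a ^+ 2 * N + (1 - a) ^+ 2 * P + d) <=
        \sum_i ((1 - a) * X i - a * block z i) ^+ 2)%R] <=
     (C * expR (- (m%:R * e)))%:E)%E].
Proof.
move=> P0 N0 a0 d0.
(* The first two terms are the second-order coefficients from z^2 and from the cross term. The third
   is added so that [th = d / (2 * K)], the maximiser of th d - th^2 K, also satisfies the side
   condition of the Chernoff bound. *)
pose K := 4 * a ^+ 4 * N ^+ 2 + 4 * N * a ^+ 2 * (1 - a) ^+ 2 * P + 2 * d * a ^+ 2 * N.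
have a2 : 0 < a ^+ 2 by rewrite exprn_gt0.
have K1 : 0 <= 4 * a ^+ 4 * N ^+ 2 by rewrite !mulr_ge0 ?exprn_ge0 ?(ltW a0) ?(ltW N0).
have K2 : 0 <= 4 * N * a ^+ 2 * (1 - a) ^+ 2 * P.
  exact: mulr_ge0 (mulr_ge0 (mulr_ge0 (mulr_ge0 (ler0n _ 4) (ltW N0)) (ltW a2))
    (sqr_ge0 _)) (ltW P0).
have K3 : 0 < 2 * d * a ^+ 2 * N by exact: mulr_gt0 (mulr_gt0 (mulr_gt0 (ltr0Sn _ 1) d0) a2) N0.
have K0 : 0 < K by rewrite /K; lra.
pose th := d / (2 * K).
have th0 : 0 < th by apply: divr_gt0 => //; exact: mulr_gt0.
pose l := th * a ^+ 2.
exists (expR (l * N + 4 * l ^+ 2 * N ^+ 2)), (th * d / 2).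
split; [exact: expR_gt0|by apply: divr_gt0 => //; exact: mulr_gt0|].
move=> m X XP; set D := a ^+ 2 * N + _ + d.
pose mu (i : 'I_m.+1) := oapp (fun k => - (2 * th * a * (1 - a) * X k)) 0 (unlift ord0 i).
pose t := th * (m%:R * D - (1 - a) ^+ 2 * \sum_i X i ^+ 2).
apply: (@le_trans _ _ (iid (gauss N) m.+1
   [set z | (t <= \sum_i (l * tnth z i ^+ 2 + mu i * tnth z i))%R])).
  apply: le_measure; rewrite ?inE.
  - apply: measurable_superlevel; apply: measurable_sum => i; apply: measurable_funX.
    by apply: measurable_funB => //; apply: measurable_funM => //; exact: measurable_block.
  - by apply: measurable_superlevel; exact: measurable_quadratic.
  move=> z /=; rewrite -(ler_pM2l th0) => H.
  rewrite big_ord_recl /mu unlift_none/= mul0r addr0.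
  apply: ler_wpDl; first by rewrite mulr_ge0 ?sqr_ge0// mulr_ge0 ?(ltW th0) ?(ltW a2).
  rewrite /t mulrBr lerBlDr; apply: (le_trans H); rewrite le_eqVlt; apply/orP; left.
  apply/eqP; rewrite !mulr_sumr -big_split/=; apply: eq_bigr => i _.
  by rewrite liftK/= /block /l; ring.
have lN : 2 * l * N <= 2^-1.
  rewrite (_ : 2 * l * N = (2 * d * a ^+ 2 * N) / K / 2); last first.
    by rewrite /l /th; field; rewrite gt_eqF.
  rewrite ler_pdivrMr// mulVf// ler_pdivrMr// mul1r /K; lra.
apply: le_trans (iid_chernoff _ _ N0 lN) _.
have muE : \sum_i mu i ^+ 2 = 4 * th ^+ 2 * a ^+ 2 * (1 - a) ^+ 2 * \sum_i X i ^+ 2.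
  rewrite big_ord_recl /mu unlift_none/= expr0n add0r mulr_sumr.
  by apply: eq_bigr => i _; rewrite liftK/=; ring.
rewrite lee_fin -expRD ler_expR muE -subr_ge0 -(natr1 m) /t.
move: (\sum_i X i ^+ 2) XP => S SP.
have -> : l * N + 4 * l ^+ 2 * N ^+ 2 - m%:R * (th * d / 2) -
   ((m%:R + 1) * (l * N + 4 * l ^+ 2 * N ^+ 2) +
   N * (4 * th ^+ 2 * a ^+ 2 * (1 - a) ^+ 2 * S) -
   th * (m%:R * D - (1 - a) ^+ 2 * S)) =
   (m%:R * P - S) * (N * (4 * th ^+ 2 * a ^+ 2 * (1 - a) ^+ 2) + th * (1 - a) ^+ 2) +
   m%:R * (th ^+ 2 * (2 * d * a ^+ 2 * N)) + m%:R * th * (d / 2 - th * K).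
  by rewrite /D /l /K; field.
have -> : d / 2 - th * K = 0 by rewrite /th; field; rewrite gt_eqF.
rewrite mulr0 addr0 addr_ge0//.
  apply: mulr_ge0; rewrite ?subr_ge0//; apply: addr_ge0.
    exact: mulr_ge0 (ltW N0) (mulr_ge0 (mulr_ge0 (mulr_ge0 (ler0n _ 4) (sqr_ge0 _))
      (ltW a2)) (sqr_ge0 _)).
  exact: mulr_ge0 (ltW th0) (sqr_ge0 _).
exact: mulr_ge0 (ler0n _ _) (mulr_ge0 (sqr_ge0 _) (ltW K3)).
Qed.

(** Chernoff at four times the mean energy: l = 1 / (4 Q) gives l Q + 4 l^2 Q^2 = 1/2 per symbol
    against a threshold of 1 per symbol. *)
Lemma state_energy_tail (Q a : R) m : 0 < Q -> 0 <= a ->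
  (iid (gauss Q) m.+1 [set s | ((a * Num.sqrt (4 * Q * m.+1%:R)) ^+ 2 <
      \sum_(i < m) (a * block s i) ^+ 2)%R] <= (expR (- (m.+1%:R * 2^-1)))%:E)%E.
Proof.
move=> Q0 a0.
pose l := (4 * Q)^-1.
have lQ : l * Q = 4^-1 by rewrite /l; field; rewrite gt_eqF.
apply: (@le_trans _ _ (iid (gauss Q) m.+1
   [set z | (m.+1%:R <= \sum_i (l * tnth z i ^+ 2 + (fun=> 0) i * tnth z i))%R])).
  apply: le_measure; rewrite ?inE.
  - apply: measurable_strict_superlevel.
    apply: measurable_sum => i; apply: measurable_funX.
    by apply: measurable_funM => //; exact: measurable_block.
  - by apply: measurable_superlevel; exact: measurable_quadratic.
  move=> s /=; rewrite exprMn sqr_sqrtr ?mulr_ge0 ?(ltW Q0)//.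
  under eq_bigr do rewrite exprMn.
  rewrite -mulr_sumr => H.
  (* The strict inequality defining the event rules out a = 0. *)
  have a2 : 0 < a ^+ 2.
    rewrite lt_def sqr_ge0 andbT; apply/eqP => a2; move: H.
    by rewrite a2 !mul0r ltxx.
  move: H; rewrite ltr_pM2l// => /ltW H.
  under eq_bigr do rewrite mul0r addr0.
  rewrite -mulr_sumr /l mulrC ler_pdivlMr ?mulr_gt0// mulrC; apply: (le_trans H).
  by rewrite big_ord_recl lerDr sqr_ge0.
have lQ2 : 2 * l * Q <= 2^-1 by rewrite -mulrA lQ; lra.
apply: le_trans (iid_chernoff _ _ Q0 lQ2) _.
rewrite lee_fin ler_expR big1 => [|i _]; last by rewrite expr0n.
rewrite (_ : 4 * l ^+ 2 * Q ^+ 2 = 4 * (l * Q) ^+ 2); last by ring.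
by rewrite lQ; move: (m.+1%:R) => k; lra.
Qed.

(** The radius ratio must be a quotient of positive integers because both radii are whole multiples
    of a common length in the grid. *)
Lemma ratio_between (lo hi : R) : 0 <= lo -> lo < hi ->
  exists x y : nat, lo < x.+1%:R / y.+1%:R < hi.
Proof.
move=> lo0 lohi.
pose y := Num.truncn (hi - lo)^-1; pose x := Num.truncn (lo * y.+1%:R).
have d0 : 0 < hi - lo by rewrite subr_gt0.
exists x, y; rewrite ltr_pdivlMr// truncnS_gt/= ltr_pdivrMr// -natr1.
have x1 : x%:R <= lo * y.+1%:R by rewrite truncn_le// mulr_ge0.
have : 1 < (hi - lo) * y.+1%:R by rewrite -ltr_pdivrMl// mulr1 truncnS_gt.
by rewrite mulrBl => ?; lra.
Qed.

End achievability.

(** * Choice of the parameters and the capacity region *)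

Section capacity.
Context (R : realType).

(** Half of the exponent is spent on absorbing the linear factor. *)
Lemma linear_exp_le (g : R) k : 0 < g ->
  (k%:R + 1) * expR (- (k%:R * g)) <= (2 / g + 1) * expR (- (k%:R * (g / 2))).
Proof.
move=> g0; rewrite (_ : - (k%:R * g) = - (k%:R * (g / 2)) - k%:R * (g / 2)); last by field.
rewrite expRD mulrA ler_pM2r ?expR_gt0//.
have kg0 : 0 <= k%:R * (g / 2) by rewrite mulr_ge0// divr_ge0// ltW.
rewrite expRN -ler_pdivlMr ?invr_gt0 ?expR_gt0// invrK.
have e1 : 1 <= expR (k%:R * (g / 2)) by rewrite -[leLHS]expR0 ler_expR.
have e2 := expR_ge1Dx (k%:R * (g / 2)).
rewrite mulrDl mul1r lerD//.
rewrite -ler_pdivrMl ?divr_gt0// invf_div mulrC; apply: le_trans e2.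
by rewrite lerDr.
Qed.

Lemma achievable_interior (P1 P2 Q0 N : R) (r : R * R) :
  0 < P1 -> 0 < P2 -> 0 < Q0 -> 0 < N -> 0 <= r.1 -> 0 <= r.2 ->
  r.1 + r.2 < 2^-1 * log2 (1 + (Num.sqrt P1 + Num.sqrt P2) ^+ 2 / N) ->
  achievable P1 P2 Q0 N r.
Proof.
move=> P10 P20 Q00 N0 r1 r2.
pose P := (Num.sqrt P1 + Num.sqrt P2) ^+ 2; rewrite -/P.
have P0 : 0 < P by rewrite exprn_gt0// addr_gt0// sqrtr_gt0.
pose V := P + N; have V0 : 0 < V by rewrite addr_gt0.
have ln2 : 0 < ln 2 :> R by rewrite ln_gt0// ltr1n.
have VN0 : 0 < V / N by rewrite divr_gt0.
have -> : 1 + P / N = V / N by rewrite /V; field; rewrite gt_eqF.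
rewrite /log2 mulrA ltr_pdivlMr// => rC.
pose T := (r.1 + r.2) * ln 2; rewrite -/T in rC.
have T0 : 0 <= T by rewrite mulr_ge0 ?addr_ge0// ltW.
(* The room left by a rate below capacity: [rho] is put above sqrt (N / V), to accept the true
   codeword, and below e^(-T), to reject the others. *)
have lohi : expR (- (2^-1 * ln (V / N))) < expR (- T) by rewrite ltr_expR ltrN2.
have [x [y /andP[rho_gt rho_lt]]] := ratio_between (expR_ge0 _) lohi.
pose rho : R := x.+1%:R / y.+1%:R; rewrite -/rho in rho_gt rho_lt.
have rho0 : 0 < rho by rewrite divr_gt0.
have NV : N / V < rho ^+ 2.
  have -> : N / V = expR (- (2^-1 * ln (V / N))) ^+ 2.
    by rewrite -expRM_natr mulNr mulrAC mulVf// mul1r expRN lnK// invf_div.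
  by rewrite ltrXn2r// ?nnegrE ?expR_ge0// ltW.
pose g := - ln rho - T.
have g0 : 0 < g.
  by rewrite subr_gt0 -ltr_expR expRN lnK// -ltf_pV2 ?posrE ?invr_gt0 ?expR_gt0// invrK -expRN.
(* Linear estimation coefficient: it minimises a^2 N + (1 - a)^2 P, with minimum P N / V. The slack
   [d] below is what rho^2 P leaves above this minimum. *)
pose a := P / V; have a0 : 0 < a by rewrite divr_gt0.
pose d := (rho ^+ 2 - N / V) * P.
have d0 : 0 < d by rewrite mulr_gt0// subr_gt0.
have [Cn [e [Cn0 e0 noise]]] := effective_noise_tail P0 N0 a0 d0.
have DE : a ^+ 2 * N + (1 - a) ^+ 2 * P + d = rho ^+ 2 * P.
  by rewrite /d /a /V; field; rewrite gt_eqF.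
pose K := 2 * expR T * (2 / g + 1).
pose bound (k : nat) : R := expR (- (k.+1%:R * 2^-1)) +
  (expR 1 * expR (- (k.+1%:R * 1)) + K * expR (g / 2) * expR (- (k.+1%:R * (g / 2)))) +
  Cn * expR e * expR (- (k.+1%:R * e)).
have bound0 : bound k @[k --> \oo] --> 0.
  rewrite -[X in _ --> X]addr0; apply: cvgD; last first.
    rewrite -[X in _ --> X](mulr0 (Cn * expR e)).
    by apply: cvgM; [exact: cvg_cst|exact: cvg_expRN].
  rewrite -[X in _ --> X]addr0; apply: cvgD; first exact: cvg_expRN.
  rewrite -[X in _ --> X]addr0; apply: cvgD.
    rewrite -[X in _ --> X](mulr0 (expR 1)).
    by apply: cvgM; [exact: cvg_cst|exact: cvg_expRN].
  rewrite -[X in _ --> X](mulr0 (K * expR (g / 2))).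
  by apply: cvgM; [exact: cvg_cst|apply: cvg_expRN; exact: divr_gt0].
have codes k : exists C : Defs.code R k.+1 (num_msg r.1 k.+1) (num_msg r.2 k.+1),
    power_constraint C Q0 P1 P2 /\
    ((0 < k)%N -> (error_prob C Q0 N <= (bound k)%:E)%E).
  have M1 := num_msg_gt0 k.+1 r1; have M2 := num_msg_gt0 k.+1 r2.
  (* At length 1 there is no room for a dirty paper block. A code without codewords meets the power
     constraint, and its error probability does not affect the limit. *)
  have [k0|k0] := posnP k.
    exists (dpc_code P1 P2 0 0 M1 M2 (fun _ (_ : 'I_0) _ => 0)).
    by split=> //; exact: dpc_power.
  have stail := state_energy_tail k Q00 (ltW a0).
  have ntail X : \sum_i X i ^+ 2 <= k%:R * P -> _ := noise k X.
  rewrite DE in ntail.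
  have [C [pow errC]] := random_coding_bound P10 P20
    (mulr_ge0 (ltW a0) (sqrtr_ge0 (4 * Q0 * k.+1%:R))) k0 M1 M2 stail ntail.
  exists C; split=> // _; apply: le_trans errC _; rewrite lee_fin /bound.
  (* Length [k.+1] leaves only k dirty paper symbols; the lost one turns into constant factors of
     [bound]. *)
  have shiftk (c : R) : expR (- (k%:R * c)) = expR c * expR (- (k.+1%:R * c)).
    by rewrite -expRD -natr1; congr expR; ring.
  rewrite (shiftk e) mulrA lerD2r lerD2l.
  apply: lerD; first by rewrite -shiftk mulr1.
  rewrite -[K * _ * _]mulrA -shiftk /K -/rho.
  have MM : (num_msg r.1 k.+1 * num_msg r.2 k.+1)%:R <= expR T * expR (k%:R * T).
    rewrite natrM; apply: le_trans (ler_pM _ _ (num_msg_le _ _) (num_msg_le _ _)) _ => //.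
    by rewrite -!expRD ler_expR le_eqVlt; apply/orP; left; apply/eqP; rewrite /T -natr1; ring.
  (* By definition of [g], rho = e^(-g - T): the packing ratio cancels the e^(k T) messages and
     leaves e^(-k g). *)
  have rhoE : rho ^+ k = expR (- (k%:R * g)) * expR (- (k%:R * T)).
    rewrite -expRD -{1}(lnK rho0) -expRM_natl; congr expR; rewrite /g; ring.
  apply: (@le_trans _ _ (2 * (expR T * expR (k%:R * T)) * (k%:R + 1) * rho ^+ k)).
    by rewrite ler_wpM2r ?exprn_ge0 ?(ltW rho0)// ler_wpM2r ?addr_ge0// ler_wpM2l.
  rewrite rhoE (_ : _ * _ = 2 * expR T * ((k%:R + 1) * expR (- (k%:R * g))) *
    (expR (k%:R * T) * expR (- (k%:R * T)))); last by ring.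
  rewrite -[expR (k%:R * T) * _]expRD subrr expR0 mulr1 -[leRHS]mulrA.
  by rewrite ler_wpM2l ?mulr_ge0 ?expR_ge0// linear_exp_le.
exists (fun k => projT1 (cid (codes k))); split=> [k|].
  by case: cid => C [].
apply: (@squeeze_cvge _ _ _ _ (fun=> 0%E) _ (fun k => (bound k)%:E)).
- exists 1%N => // k /= k0; case: cid => C /= [_ errC].
  by rewrite error_prob_ge0 errC.
- exact: cvg_cst.
- by apply: cvg_EFin => //; exact: nearW.
Qed.

End capacity.

Theorem mainTheorem4 (R : realType) (P1 P2 Q0 N : R)
    (P1_gt0 : 0 < P1) (P2_gt0 : 0 < P2) (Q0_gt0 : 0 < Q0) (N_gt0 : 0 < N) :
  capacity_region P1 P2 Q0 N =
  [set r : R * R | [/\ 0 <= r.1, 0 <= r.2 &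
    r.1 + r.2 <=
      2^-1 * log2 (1 + (Num.sqrt P1 + Num.sqrt P2) ^+ 2 / N)]].
Proof.
set cap := 2^-1 * _.
have cap_gt0 : 0 < cap.
  rewrite mulr_gt0 ?invr_gt0// /log2 divr_gt0// ln_gt0 ?ltr1n// ltrDl divr_gt0//.
  by rewrite exprn_gt0// addr_gt0 ?sqrtr_gt0.
apply/seteqP; split.
  have cl : closed [set r : R * R | [/\ 0 <= r.1, 0 <= r.2 & r.1 + r.2 <= cap]].
    rewrite (_ : mkset _ = (fst @^-1` [set x | 0 <= x]) `&`
      ((snd @^-1` [set x | 0 <= x]) `&`
       ((fun r : R * R => r.1 + r.2) @^-1` [set x | x <= cap]))); last first.
      by apply/seteqP; split=> r /=; [move=> [? ? ?]|move=> [? [? ?]]].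
    apply: closedI; last apply: closedI.
    - by apply: closed_comp => [r _|]; [exact: cvg_fst|exact: closed_ge].
    - by apply: closed_comp => [r _|]; [exact: cvg_snd|exact: closed_ge].
    - apply: closed_comp => [r _|]; last exact: closed_le.
      by apply: cvgD; [exact: cvg_fst|exact: cvg_snd].
  rewrite [X in _ `<=` X]((closure_id _).1 cl); apply: closure_subset => r ach.
  have [r1 r2] := achievable_ge0 ach.
  by split=> //; exact: achievable_sum_le ach.
move=> r [r1 r2 rcap] U Ur.
(* Scaling towards the origin keeps both rates nonnegative and, as [cap] is positive, makes the sum
   constraint strict. Each point of the triangle is thus a limit of points covered by
   [achievable_interior]. *)
have cv : (t * r.1, t * r.2) @[t --> (1:R)^'-] --> r.
  have E : r = (1 * r.1, 1 * r.2) by rewrite !mul1r; case: (r).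
  rewrite [X in _ --> X]E; apply: cvg_at_left_filter.
  by apply: (@cvg_pair _ _ _ _ (nbhs (1 * r.1)) (nbhs (1 * r.2))); apply: cvgM;
    [exact: cvg_id|exact: cvg_cst|exact: cvg_id|exact: cvg_cst].
near (1:R)^'- => t.
exists (t * r.1, t * r.2); split; last by near: t; exact: cv _ Ur.
have t0 : 0 < t by near: t; apply: nbhs_left_gt; exact: ltr01.
have t1 : t < 1 by near: t; exact: nbhs_left_lt.
apply: achievable_interior => //=; [by rewrite mulr_ge0 ?(ltW t0)..|].
rewrite -mulrDr -/cap; apply: (@le_lt_trans _ _ (t * cap)).
  by rewrite ler_wpM2l ?(ltW t0).
by rewrite gtr_pMl.
Unshelve. all: by end_near.
Qed.
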